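(* Let $\theta>0$ and let $(M_N)_{N\ge1}$ be a sequence of random matrices following the distribution $\mathbb{P}(\infty,\theta,\delta_1)$, where $\delta_1$ is the Dirac measure at one. Then the random measure $\tau_N(M_N)$ converges almost surely to the random measure $\tau_\infty((M_N)_{N\ge1})$ in the following sense: for every continuous function $f:\mathbb{R}\to\mathbb{R}_+$ with compact support, $$\int_{\mathbb{R}}f\,d\tau_N(M_N)\ \underset{N\to\infty}{\longrightarrow}\ \int_{\mathbb{R}}f\,d\tau_\infty((M_N)_{N\ge1})$$ almost surely (the limit being possibly infinite).
   Context: $\Sigma_N$ is the group of permutations of $\{1,\dots,N\}$. The Ewens measure of parameter $\theta$ on $\Sigma_N$ gives each permutation a probability proportional to $\theta^n$, $n$ being its number of cycles. A virtual permutation is a sequence $(\sigma_N)_{N\ge1}$ with $\sigma_N\in\Sigma_N$ such that for all $N$ the cycle structure of $\sigma_N$ is obtained from that of $\sigma_{N+1}$ by removing the element $N+1$ from its cycle; the Ewens($\theta$) measure on virtual permutations is the unique probability measure under which each $\sigma_N$ follows the Ewens($\theta$) measure on $\Sigma_N$. Under $\mathbb{P}(\infty,\theta,\delta_1)$, $M_N$ is the permutation matrix $(M_N)_{jk}=\mathbf{1}_{j=\sigma_N(k)}$, where $(\sigma_N)_{N\ge1}$ is a virtual permutation following the Ewens($\theta$) measure. $\tau_N(M_N)$ is the point measure on $\mathbb{R}$ $$\tau_N(M_N)=\sum_{x\in\mathbb{R}:\ e^{2i\pi x/N}\text{ eigenvalue of }M_N}m(x)\,\delta_x,$$ where $m(x)$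 is the multiplicity of the eigenvalue $e^{2i\pi x/N}$ of $M_N$. There is a partition of $\{1,2,\dots\}$ into sets whose intersections with $\{1,\dots,N\}$ are, when nonempty, the supports of the cycles of $\sigma_N$, for all $N$; a.s. it has infinitely many sets, denoted $(C_m)_{m\ge1}$ in order of increasing smallest element. Let $y_{N,m}=|C_m\cap\{1,\dots,N\}|/N$. It is known that a.s., for all $m\ge 1$, $y_{N,m}$ converges as $N\to\infty$ to a limit $y_m>0$ (and $(y_m)_{m\ge1}$ is a GEM process of parameter $\theta$). Then $\tau_\infty((M_N)_{N\ge1}):=\sum_{m=1}^\infty\sum_{k\in\mathbb{Z}}\delta_{k/y_m}$ (which has an infinite Dirac mass at zero). *)

(* Defs.v *)
From HB Require Import structures.
From mathcomp Require Import all_boot all_order all_algebra all_fingroup.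
From mathcomp Require Import complex.
From mathcomp Require Import all_classical all_reals all_analysis.

Set Implicit Arguments.
Unset Strict Implicit.
Unset Printing Implicit Defensive.

Import Order.TTheory GRing.Theory Num.Theory.
Import numFieldNormedType.Exports.

Local Open Scope classical_set_scope.
Local Open Scope ring_scope.

(* Indices are shifted by one throughout: {1, ..., N} is 'I_N = {0, ..., N-1},
   {1, 2, ...} is nat, and C_m is [nth_cycle v m.-1]. Sequences indexed by
   N >= 1 get a harmless extra term at N = 0 ('S_0 is trivial). *)

(* [s] is [s'] with the largest element taken out of its cycle. *)
Definition last_removed (N : nat) (s' : 'S_N.+1) (s : 'S_N) : Prop :=
  forall j : 'I_N, let k := s' (widen_ord (leqnSn N) j) in
    nat_of_ord (s j) = nat_of_ord (if k == ord_max then s' ord_max else k).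

Record virtual_permutation := VirtualPermutation {
  vperm :> forall N : nat, 'S_N ;
  vpermP : forall N : nat, last_removed (vperm N.+1) (vperm N) }.

Definition ewens_mass (R : realType) (theta : R) (N : nat) (s : 'S_N) : R :=
  theta ^+ #|porbits s| / \sum_(t : 'S_N) theta ^+ #|porbits t|.

(* The Ewens law on virtual permutations is the unique law, for the sigma-algebra
   generated by the coordinates, whose marginals are the Ewens measures. *)
Definition ewens_distributed (R : realType) d (Omega : measurableType d)
    (P : probability Omega R) (theta : R)
    (sigma : Omega -> virtual_permutation) : Prop :=
  forall (N : nat) (s : 'S_N),
    measurable [set w | sigma w N = s] /\
    P [set w | sigma w N = s] = (ewens_mass theta s)%:E.

(* This is [perm_mx s^-1]: the library's [perm_mx s] has its 1's at (k, s k). *)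
Definition permutation_matrix (R : realType) (N : nat) (s : 'S_N) : 'M[R[i]]_N :=
  \matrix_(j, k) (j == s k)%:R.

Section point_measure.
Context d (T : measurableType d) (R : realType) (I : choiceType).
Variables (D : set I) (w : I -> nat) (p : I -> T).

(* \sum_(i in D) w i \d_(p i) *)
Definition point_measure (A : set T) : \bar R :=
  (\esum_(i in D) ((w i)%:R%:E * \d_(p i) A))%E.

Let point_measure0 : point_measure set0 = 0%E.
Proof. by apply: esum1 => i _; rewrite measure0 mule0. Qed.

Let point_measure_ge0 A : (0 <= point_measure A)%E.
Proof. by apply: esum_ge0 => i _; rewrite mule_ge0// lee_fin. Qed.

Let point_measure_sigma_additive : semi_sigma_additive point_measure.
Proof.
move=> F mF tF mUF.
have -> : point_measure (\bigcup_n F n) = (\sum_(n <oo) point_measure (F n))%E.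
  rewrite nneseries_esumT; last by move=> n; exact: point_measure_ge0.
  have wd_ge0 i n : (0 <= (w i)%:R%:E * \d_(p i) (F n) :> \bar R)%E.
    by rewrite mule_ge0// lee_fin.
  rewrite /point_measure esum_esum; last by move=> n i _ _.
  transitivity (\esum_(i in D) \esum_(n in [set: nat])
      ((w i)%:R%:E * \d_(p i) (F n)) : \bar R)%E; last first.
    rewrite esum_esum; last by move=> i n _ _.
    rewrite [RHS](reindex_esum (D `*` [set: nat]) _ (fun x => (x.2, x.1)))//=.
    split.
    + by move=> [i n] [].
    + by move=> [i n] [j m] _ _ /= [-> ->].
    + by move=> [n i] [/= _ Di]; exists (i, n).
  apply: eq_esum => i Di.
  rewrite (measure_semi_bigcup _ mF tF mUF) -nneseriesZl//.
  by rewrite nneseries_esumT.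
by apply: is_cvg_ereal_nneg_natsum => n _; exact: point_measure_ge0.
Qed.

HB.instance Definition _ := isMeasure.Build _ _ _ point_measure
  point_measure0 point_measure_ge0 point_measure_sigma_additive.

End point_measure.
Arguments point_measure {d T} R {I} D w p A.

Section eigenangles.
Variable R : realType.

(* e^(2 i pi x / N) *)
Definition unit_circle (N : nat) (x : R) : R[i] :=
  let t := 2 * pi * x / N%:R in Complex (cos t) (sin t).

Definition tau (N : nat) (M : 'M[R[i]]_N) : {measure set R -> \bar R} :=
  point_measure R [set x : R | eigenvalue M (unit_circle N x)]
    (fun x => mup (unit_circle N x) (char_poly M)) id.

End eigenangles.

Section limit_measure.
Variables (R : realType) (v : virtual_permutation).

Definition trace (C : set nat) (N : nat) : {set 'I_N} :=
  finset (fun i : 'I_N => (i : nat) \in C).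

(* The blocks of the partition of nat determined by [v]. *)
Definition infinite_cycle (C : set nat) : Prop :=
  C !=set0 /\
  forall N : nat, trace C N != finset.set0 -> trace C N \in porbits (v N).

Definition is_smallest (C : set nat) (i : nat) : Prop :=
  C i /\ forall j, C j -> (i <= j)%N.

Definition is_cycle_min (i : nat) : Prop :=
  exists2 C, infinite_cycle C & is_smallest C i.

(* The block whose smallest element is preceded by those of exactly [m] other
   blocks; set0 when there are at most [m] blocks. *)
Definition nth_cycle (m : nat) : set nat :=
  xget set0 [set C | infinite_cycle C /\
    exists2 i, is_smallest C i & #|[pred j : 'I_i | `[< is_cycle_min j >]]| = m].

Definition cycle_frequency (m N : nat) : R :=
  #|trace (nth_cycle m) N|%:R / N%:R.

(* Unspecified on the null event where the limit does not exist. *)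
Definition cycle_length (m : nat) : R :=
  limn (cycle_frequency m).

Definition tau_infty : {measure set R -> \bar R} :=
  point_measure R [set: nat * int] (fun=> 1%N)
    (fun mk => mk.2%:~R / cycle_length mk.1).

End limit_measure.
Arguments tau_infty R v : clear implicits.

(* Main.v *)
Require Import Defs.
From mathcomp Require Import all_boot all_order all_algebra all_fingroup.
From mathcomp Require Import complex.
From mathcomp Require Import ring lra zify.
From mathcomp Require Import all_classical all_reals all_analysis.
From mathcomp Require Import measurable_realfun.

(** A cycle of length [n] of a permutation contributes the factor [X^n - 1] to
the characteristic polynomial of its matrix ([char_poly_permutation_matrix]), and
the roots of [X^n - 1] are simple. Hence the rescaled eigenangles of [sigma_N]
are the points [k / y], with [k] an integer and [y] the proportion of
[{0, ..., N-1}] lying in a cycle, each pair (cycle, [k]) counting once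
([integral_tau]). The limit measure has the same shape, with limiting
proportions ([integral_tau_infty]).

If [f 0 > 0], every cycle contributes at least [f 0] through [k = 0], so both
sides are infinite as soon as there are infinitely many cycles. If [f 0 = 0] and
[f] vanishes outside [[-A, A]], a pair with [k <> 0] contributes only if
[y >= 1 / A] and [|k| <= A]. When all but finitely many cycles remain below the
proportion [1 / A], uniformly in large [N], both integrals are sums over one
fixed finite box of pairs, and the convergence is termwise ([tau_cvg]).

What is left is probabilistic, and is collected in [regular_growth]: the
proportions converge, no mass is lost to late cycles, and there are infinitely
many cycles. All three facts are read off one family of statistics: the number
[V_N i] of elements of [{0, ..., N-1}] whose cycle meets [{0, ..., i-1}]
([old_count]). Indeed the cycle with smallest element [i] has
[V_N (i + 1) - V_N i] elements below [N].

The Ewens measure on [N + 1] elements is obtained from the one on [N] elements by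
inserting the new element next to a given old one with probability
[1 / (N + theta)], or alone with probability [theta / (N + theta)]. Therefore,
conditionally on [sigma_N], the statistic [V i] increases by one with probability
[V_N i / (N + theta)] ([ewens_mean_markov]), and [X_N = V_N i / (N + theta)] is a
bounded martingale.

- Convergence: [E (X_N - X_n)^2] is at most [(N - n) / (n + 1)^2], so along the
  cubes [n_k = k^3] the sum of [E |X_{n_{k+1}} - X_{n_k}|] is finite and [X]
  converges almost surely along the cubes. Consecutive terms differ by at most
  [1 / (N + 1)], which fills the gaps between cubes ([cvg_of_cubes]).
- No loss of mass: [E (1 - X_N)] is constantly [theta / (i + theta)], which
  tends to 0 with [i]; Fatou's lemma is applied in [N], then in [i].
- New cycles: [P (V_N i = N)] is the product of the [j / (j + theta)], which
  tends to 0 because the harmonic series diverges ([mean_all_old]). *)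

Import Order.TTheory GRing.Theory Num.Theory.
Import numFieldNormedType.Exports.

Set Implicit Arguments.
Unset Strict Implicit.

Local Open Scope classical_set_scope.
Local Open Scope ring_scope.

(** * Removing and inserting the largest element *)

Definition widenS {N : nat} : 'I_N -> 'I_N.+1 := widen_ord (leqnSn N).

Lemma widenS_inj N : injective (@widenS N).
Proof. by move=> i j /(congr1 val) /= /val_inj. Qed.

Lemma widenS_neq_max N (j : 'I_N) : widenS j != ord_max.
Proof. by rewrite -val_eqE /= neq_ltn ltn_ord. Qed.

Lemma lift_maxE N (j : 'I_N) : lift ord_max j = widenS j.
Proof. by apply: val_inj; rewrite /= /bump leqNgt ltn_ord. Qed.

Lemma widenSP N (k : 'I_N.+1) : k = ord_max \/ exists j, k = widenS j.
Proof.
by case: (unliftP ord_max k) => [j|] ->; [right; exists j; rewrite lift_maxE | left].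
Qed.

Lemma last_removedE N (s' : 'S_N.+1) (s : 'S_N) : last_removed s' s ->
  forall j, widenS (s j) =
    if s' (widenS j) == ord_max then s' ord_max else s' (widenS j).
Proof. by move=> h j; apply: val_inj; exact: h. Qed.

Lemma porbit_image (T : finType) (s : {perm T}) x : porbit s (s x) = porbit s x.
Proof. exact: (porbit_perm s 1 x). Qed.

(** Following an orbit of [s'] from an old element to an old element and erasing
the visits to [ord_max] gives the orbit of [s], and conversely. *)
Lemma porbit_last_removed N (s' : 'S_N.+1) (s : 'S_N) : last_removed s' s ->
  forall j k, (widenS k \in porbit s' (widenS j)) = (k \in porbit s j).
Proof.
move=> /last_removedE h j k; apply/idP/idP; last first.
  move=> /porbitP[n ->]; elim: n j => [|n IH] j.
    by rewrite expg0 perm1 porbit_id.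
  rewrite expgS permM; suff <- : porbit s' (widenS (s j)) = porbit s' (widenS j) by exact: IH.
  rewrite h; case: eqP => [<-|_]; last exact: porbit_image.
  by rewrite !porbit_image.
move=> /porbitP[n]; have [m] := ubnP n; elim: m => // m IH in n j *.
case: n => [|n]; first by rewrite expg0 perm1 => _ /widenS_inj ->; exact: porbit_id.
rewrite ltnS expgS permM => nm; rewrite -[porbit s j]porbit_image.
have := h j; case: eqP => [->|_] hj; last by rewrite -hj; exact: IH.
case: n nm => [|n] nm.
  by rewrite expg0 perm1 => E; have := widenS_neq_max k; rewrite E eqxx.
by rewrite expgS permM -hj; apply: IH; exact: ltnW.
Qed.

(** The new element is inserted just after [k] in the cycle of [k], and forms a
cycle of its own when [k] is the new element itself. *)
Definition insert_max (N : nat) (s : 'S_N) (k : 'I_N.+1) : 'S_N.+1 :=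
  (tperm k ord_max * lift_perm ord_max ord_max s)%g.

Lemma insert_maxE N (s : 'S_N) k : insert_max s k k = ord_max.
Proof. by rewrite permM tpermL lift_perm_id. Qed.

Lemma insert_max_removed N (s : 'S_N) k : last_removed (insert_max s k) s.
Proof.
move=> j /=; have [e|kj] := eqVneq k (widenS j).
  rewrite -/(widenS j) -e insert_maxE eqxx permM tpermR e -lift_maxE lift_perm_lift.
  by rewrite lift_maxE.
rewrite permM tpermD ?widenS_neq_max//; last by rewrite eq_sym widenS_neq_max.
by rewrite -/(widenS j) -lift_maxE lift_perm_lift lift_maxE (negbTE (widenS_neq_max _)).
Qed.

Lemma insert_max_widenS N (s : 'S_N) (k : 'I_N) :
  insert_max s (widenS k) ord_max = widenS (s k).
Proof. by rewrite permM tpermR -lift_maxE lift_perm_lift lift_maxE. Qed.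

Lemma insert_max_fix N (s : 'S_N) : insert_max s ord_max ord_max = ord_max.
Proof. exact: insert_maxE. Qed.

Lemma insert_max_inj N :
  injective (fun sk : 'S_N * 'I_N.+1 => insert_max sk.1 sk.2).
Proof.
move=> [s k] [t l] /= E; have kl : k = l.
  by apply: (@perm_inj _ (insert_max s k)); rewrite insert_maxE E insert_maxE.
congr pair => //; apply/permP => j; apply: ord_inj.
by rewrite (insert_max_removed s k) (insert_max_removed t l) E.
Qed.

Lemma insert_max_bij N :
  bijective (fun sk : 'S_N * 'I_N.+1 => insert_max sk.1 sk.2).
Proof.
apply: inj_card_bij; first exact: insert_max_inj.
by rewrite card_prod card_ord !card_Sn factS mulnC.
Qed.

Lemma insert_maxP N (t : 'S_N.+1) : exists s k, t = insert_max s k.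
Proof. by have [g _ gK] := insert_max_bij N; exists (g t).1, (g t).2; rewrite gK. Qed.

Lemma sum_insert_max (R : nmodType) N (F : 'S_N.+1 -> R) :
  \sum_t F t = \sum_s (F (insert_max s ord_max) + \sum_k F (insert_max s (widenS k))).
Proof.
rewrite (reindex _ (onW_bij _ (insert_max_bij N))) /=.
rewrite -(pair_big xpredT xpredT (fun s k => F (insert_max s k))) /=.
apply: eq_bigr => s _; rewrite big_ord_recr addrC; congr (_ + _).
Qed.

Lemma porbit_insert_max N (s : 'S_N) k (i j : 'I_N) :
  (widenS i \in porbit (insert_max s k) (widenS j)) = (i \in porbit s j).
Proof. exact: porbit_last_removed (insert_max_removed s k) j i. Qed.

Lemma porbit_insert_widenS N (s : 'S_N) (k i : 'I_N) :
  (widenS i \in porbit (insert_max s (widenS k)) ord_max) = (i \in porbit s k).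
Proof.
by rewrite -{1}(insert_maxE s (widenS k)) porbit_image porbit_insert_max.
Qed.

Lemma porbit_fix (T : finType) (s : {perm T}) x : s x = x -> porbit s x = [set x]%SET.
Proof.
move=> sx; apply/setP => y; rewrite inE; apply/idP/eqP => [/porbitP[n ->]|->].
  by elim: n => [|n IH]; rewrite ?expg0 ?perm1 // expgSr permM IH.
exact: porbit_id.
Qed.

Lemma porbit_insert_fix N (s : 'S_N) (i : 'I_N) :
  (widenS i \in porbit (insert_max s ord_max) ord_max) = false.
Proof.
rewrite (porbit_fix (insert_max_fix s)) inE; exact/negbTE/widenS_neq_max.
Qed.

(** * Elements whose cycle meets an initial segment *)

Definition touches N (s : 'S_N) (i : nat) (j : 'I_N) : bool :=
  [exists k : 'I_N, (k < i)%N && (k \in porbit s j)].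

Definition old_count N (s : 'S_N) (n i : nat) : nat :=
  #|[pred j : 'I_N | (j < n)%N && touches s i j]|.

(** As [i <= N], the elements below [i] are old, so their cycles can be compared in
[s]. *)
Lemma touches_removed N (s' : 'S_N.+1) (s : 'S_N) i (j : 'I_N) :
  last_removed s' s -> (i <= N)%N -> touches s' i (widenS j) = touches s i j.
Proof.
move=> h iN; apply/existsP/existsP => -[k /andP[ki kj]].
  case: (widenSP k) => [ke|[l kl]].
    by move: ki; rewrite ke /= ltnNge iN.
  by exists l; move: ki kj; rewrite kl (porbit_last_removed h) => -> ->.
by exists (widenS k); rewrite (porbit_last_removed h) kj andbT.
Qed.

Lemma touches_insert_widenS N (s : 'S_N) i (k : 'I_N) : (i <= N)%N ->
  touches (insert_max s (widenS k)) i ord_max = touches s i k.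
Proof.
move=> iN; rewrite -(touches_removed k (insert_max_removed s (widenS k)) iN).
by rewrite /touches -{1}(insert_maxE s (widenS k)) porbit_image.
Qed.

Lemma touches_insert_fix N (s : 'S_N) i : (i <= N)%N ->
  touches (insert_max s ord_max) i ord_max = false.
Proof.
move=> iN; apply/negbTE/existsP => -[k /andP[ki]].
rewrite (porbit_fix (insert_max_fix s)) inE => /eqP ke.
by move: ki; rewrite ke /= ltnNge iN.
Qed.

Lemma card_ord_recr N (p : pred 'I_N.+1) :
  #|p| = (#|[pred j : 'I_N | p (widenS j)]| + p ord_max)%N.
Proof.
rewrite -sum1_card big_mkcond big_ord_recr /= -sum1_card [in RHS]big_mkcond /=.
by congr (_ + _)%N; rewrite /in_mem /=; case: (p _).
Qed.

Lemma old_count_removed N (s' : 'S_N.+1) (s : 'S_N) n i :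
  last_removed s' s -> (i <= N)%N -> (n <= N)%N ->
  old_count s' n i = old_count s n i.
Proof.
move=> h iN nN; rewrite /old_count card_ord_recr /= ltnNge nN addn0.
by apply: eq_card => j; rewrite !inE (touches_removed _ h).
Qed.

Lemma old_count_recr N (s : 'S_N) k i : (i <= N)%N ->
  old_count (insert_max s k) N.+1 i =
  (old_count s N i + touches (insert_max s k) i ord_max)%N.
Proof.
move=> iN; rewrite /old_count card_ord_recr /= ltnSn /=; congr (_ + _)%N.
apply: eq_card => j; rewrite !inE (touches_removed _ (insert_max_removed s k))//.
by rewrite /= !ltn_ord (ltn_trans (ltn_ord j)).
Qed.

Lemma card_touches N (s : 'S_N) i : #|[pred k | touches s i k]| = old_count s N i.
Proof. by apply: eq_card => j; rewrite !inE ltn_ord. Qed.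

Lemma old_count_le N (s : 'S_N) i : (old_count s N i <= N)%N.
Proof. by rewrite -[leqRHS]card_ord max_card. Qed.

Lemma old_count_full N (s : 'S_N) i : (N <= i)%N -> old_count s N i = N.
Proof.
move=> Ni; rewrite -[RHS]card_ord; apply: eq_card => j; rewrite !inE ltn_ord/=.
by apply/existsP; exists j; rewrite porbit_id (leq_trans _ Ni).
Qed.

Lemma old_count_mono N (s : 'S_N) n i j : (i <= j)%N ->
  (old_count s n i <= old_count s n j)%N.
Proof.
move=> ij; apply/subset_leq_card/fintype.subsetP => k; rewrite !inE => /andP[-> /=].
move=> /existsP[l /andP[li lk]]; apply/existsP; exists l.
by rewrite lk (leq_trans li).
Qed.

(** * Cycles and their smallest elements *)

Definition cycle_min N (s : 'S_N) (j : 'I_N) : bool := ~~ touches s j j.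

Lemma cycle_minP N (s : 'S_N) (j : 'I_N) :
  reflect (forall k, k \in porbit s j -> (j <= k)%N) (cycle_min s j).
Proof.
apply: (iffP existsPn) => h k; last by apply/negP => /andP[kj /h]; rewrite leqNgt kj.
by move=> kj; have := h k; rewrite kj andbT -leqNgt.
Qed.

Lemma cycle_min_inj N (s : 'S_N) (i j : 'I_N) :
  cycle_min s i -> cycle_min s j -> porbit s i = porbit s j -> i = j.
Proof.
move=> /cycle_minP mi /cycle_minP mj ij; apply/val_inj/anti_leq.
by rewrite mi ?mj// ?ij ?porbit_id// -ij porbit_id.
Qed.

(** Cycles are represented by their smallest elements, because these are stable under
insertion whereas the orbits themselves change type. *)
Lemma ex_cycle_min N (s : 'S_N) (j : 'I_N) :
  exists2 i, cycle_min s i & porbit s i = porbit s j.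
Proof.
case: (arg_minnP (P := [pred k | k \in porbit s j]) (fun k : 'I_N => k : nat) (porbit_id s j)).
move=> i /= ij h; have e : porbit s i = porbit s j by apply/eqP; rewrite eq_porbit_mem.
by exists i => //; apply/cycle_minP => k; rewrite e => /h.
Qed.

Lemma porbitsE N (s : 'S_N) : porbits s = [set porbit s j | j in cycle_min s]%SET.
Proof.
apply/setP => A; apply/imsetP/imsetP => -[j _ ->]; last by exists j.
by have [i mi ij] := ex_cycle_min s j; exists i.
Qed.

Lemma card_porbits N (s : 'S_N) : #|porbits s| = #|cycle_min s|.
Proof.
rewrite porbitsE card_in_imset// => i j mi mj; exact: cycle_min_inj.
Qed.

Lemma cycle_min_insert_widenS N (s : 'S_N) k (j : 'I_N) :
  cycle_min (insert_max s k) (widenS j) = cycle_min s j.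
Proof.
congr negb; rewrite (touches_removed _ (insert_max_removed s k))//=.
exact: ltnW.
Qed.

Lemma cycle_min_insert_max N (s : 'S_N) k :
  cycle_min (insert_max s k) ord_max = (k == ord_max).
Proof.
case: (widenSP k) => [->|[j ->]].
  by rewrite eqxx /cycle_min touches_insert_fix.
rewrite (negbTE (widenS_neq_max j)) /cycle_min touches_insert_widenS//=.
by apply/negbF/existsP; exists j; rewrite porbit_id ltn_ord.
Qed.

Lemma card_porbits_insert N (s : 'S_N) k :
  #|porbits (insert_max s k)| = (#|porbits s| + (k == ord_max))%N.
Proof.
rewrite !card_porbits card_ord_recr cycle_min_insert_max; congr (_ + _)%N.
by apply: eq_card => j; rewrite !inE; exact: cycle_min_insert_widenS.
Qed.

(** * The Ewens measures and the Markov property *)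

Section ewens.
Variables (R : realType) (theta : R).
Hypothesis theta_gt0 : 0 < theta.

Definition ewens_mean N (h : 'S_N -> R) : R := \sum_s h s * ewens_mass theta s.

Let Z N : R := \sum_(t : 'S_N) theta ^+ #|porbits t|.

Let Z_gt0 N : 0 < Z N.
Proof.
rewrite /Z (bigD1 1%g)//= ltr_wpDr//; last by rewrite exprn_gt0.
by apply: sumr_ge0 => t _; rewrite exprn_ge0// ltW.
Qed.

Lemma natD_theta_gt0 (N : nat) : 0 < N%:R + theta.
Proof. by rewrite ltr_wpDl. Qed.

Lemma ewens_mass_ge0 N (s : 'S_N) : 0 <= ewens_mass theta s.
Proof. by rewrite divr_ge0 ?exprn_ge0 ?ltW//; exact: Z_gt0. Qed.

(** Insertion creates a cycle only at the new element, which costs one factor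
[theta]; the normalizing constants therefore satisfy
[Z (N + 1) = (N + theta) * Z N]. *)
Lemma ewens_mean_insert N (h : 'S_N.+1 -> R) :
  ewens_mean h = ewens_mean (fun s =>
    (theta * h (insert_max s ord_max) + \sum_k h (insert_max s (widenS k))) /
    (N%:R + theta)).
Proof.
have step (g : 'S_N.+1 -> R) : \sum_t g t * theta ^+ #|porbits t| =
    \sum_s (theta * g (insert_max s ord_max) + \sum_k g (insert_max s (widenS k))) *
      theta ^+ #|porbits s|.
  rewrite sum_insert_max; apply: eq_bigr => s _.
  rewrite card_porbits_insert eqxx addn1 exprS mulrDl mulr_suml.
  congr (_ + _); first by rewrite mulrCA mulrA.
  apply: eq_bigr => k _.
  by rewrite card_porbits_insert (negbTE (widenS_neq_max k)) addn0.
have ZS : Z N.+1 = (N%:R + theta) * Z N.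
  have := step (fun=> 1); under eq_bigr do rewrite mul1r.
  rewrite -/(Z _) => ->; rewrite mulr_sumr; apply: eq_bigr => s _.
  by rewrite mulr1 sumr_const card_ord addrC.
rewrite /ewens_mean /ewens_mass -/(Z N.+1) -/(Z N) ZS.
under eq_bigr do rewrite mulrA.
rewrite -mulr_suml step mulr_suml; apply: eq_bigr => s _.
by rewrite invfM mulrACA.
Qed.

Lemma ewens_mean1 N : ewens_mean (fun _ : 'S_N => 1) = 1.
Proof.
rewrite /ewens_mean; under eq_bigr do rewrite mul1r.
by rewrite -mulr_suml divff// gt_eqF// Z_gt0.
Qed.

Lemma ewens_meanD N (g h : 'S_N -> R) :
  ewens_mean (fun s => g s + h s) = ewens_mean g + ewens_mean h.
Proof. by rewrite -big_split; apply: eq_bigr => s _; rewrite mulrDl. Qed.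

Lemma ewens_meanZ N c (h : 'S_N -> R) :
  ewens_mean (fun s => c * h s) = c * ewens_mean h.
Proof. by rewrite mulr_sumr; apply: eq_bigr => s _; rewrite mulrA. Qed.

Lemma ewens_mean_cst N c : ewens_mean (fun _ : 'S_N => c) = c.
Proof.
by rewrite -[RHS]mulr1 -(ewens_mean1 N) -ewens_meanZ; apply: eq_bigr => s _; rewrite mulr1.
Qed.

Lemma le_ewens_mean N (g h : 'S_N -> R) : (forall s, g s <= h s) ->
  ewens_mean g <= ewens_mean h.
Proof. by move=> gh; apply: ler_sum => s _; rewrite ler_wpM2r// ewens_mass_ge0. Qed.

Lemma ewens_mean_ge0 N (h : 'S_N -> R) : (forall s, 0 <= h s) -> 0 <= ewens_mean h.
Proof. by move=> h0; apply: sumr_ge0 => s _; rewrite mulr_ge0// ewens_mass_ge0. Qed.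

Lemma eq_ewens_mean N (g h : 'S_N -> R) : g =1 h -> ewens_mean g = ewens_mean h.
Proof. by move=> gh; apply: eq_bigr => s _; rewrite gh. Qed.

(** The new element becomes old when it is inserted next to one of the [v] old
elements, hence with probability [v / (N + theta)]. The function [g] may depend
on the whole of [s], so that the statement is about conditional expectations given
the past. *)
Lemma ewens_mean_markov N i (h : 'S_N.+1 -> R) (g : 'S_N -> nat -> R) :
  (i <= N)%N ->
  (forall s k, h (insert_max s k) = g s (old_count (insert_max s k) N.+1 i)) ->
  ewens_mean h = ewens_mean (fun s =>
    let v := old_count s N i in
    let x := v%:R / (N%:R + theta) in x * g s v.+1 + (1 - x) * g s v).
Proof.
move=> iN hg; rewrite ewens_mean_insert; apply: eq_ewens_mean => s /=.
set v := old_count s N i.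
have hmax : h (insert_max s ord_max) = g s v.
  by rewrite hg old_count_recr// touches_insert_fix// addn0.
have hwid k : h (insert_max s (widenS k)) = if touches s i k then g s v.+1 else g s v.
  by rewrite hg old_count_recr// touches_insert_widenS//; case: ifP; rewrite (addn0,addn1).
rewrite hmax; under eq_bigr do rewrite hwid.
rewrite (bigID (touches s i)) /=.
under eq_bigr => k tk do rewrite tk.
under [X in _ + (_ + X)]eq_bigr => k tk do rewrite (negbTE tk).
have cv : #|[pred k | touches s i k]| = v by exact: card_touches.
have cv' : #|[pred k | ~~ touches s i k]| = (N - v)%N.
  have := cardC [pred k | touches s i k]; rewrite card_ord cv => vN.
  have -> : (N - v = (v + #|[predC [pred k | touches s i k]]|) - v)%N by rewrite vN.
  by rewrite addKn; apply: eq_card.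
have S1 (c : R) : \sum_(k | touches s i k) c = v%:R * c.
  by rewrite sumr_const mulr_natl; congr (_ *+ _); rewrite -cv; apply: eq_card.
have S2 (c : R) : \sum_(k | ~~ touches s i k) c = (N%:R - v%:R) * c.
  rewrite -natrB ?old_count_le// sumr_const mulr_natl; congr (_ *+ _).
  by rewrite -cv'; apply: eq_card.
rewrite S1 S2.
have := natD_theta_gt0 N; move: (g s v.+1) (g s v) (v%:R : R) (N%:R : R).
by move=> a b c n n0; field; lra.
Qed.

End ewens.

(** * Moments of the proportion of old elements *)

Section moments.
Variables (R : realType) (theta : R).
Hypothesis theta_gt0 : 0 < theta.

(** Dividing by [n + theta] rather than [n] makes this a martingale in [n]. *)
Definition old_ratio N (s : 'S_N) (n i : nat) : R :=
  (old_count s n i)%:R / (n%:R + theta).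

Local Notation E := (ewens_mean theta).

Lemma mean_old_ratio N i : (i <= N)%N ->
  E (fun s : 'S_N => old_ratio s N i) = i%:R / (i%:R + theta).
Proof.
elim: N => [|N IH].
  rewrite leqn0 => /eqP ->; rewrite -[RHS](ewens_mean_cst theta_gt0 0).
  by apply: eq_ewens_mean => s; rewrite /old_ratio old_count_full.
rewrite leq_eqVlt => /predU1P[->|iN].
  rewrite -[RHS](ewens_mean_cst theta_gt0 N.+1).
  by apply: eq_ewens_mean => s; rewrite /old_ratio old_count_full.
rewrite -IH// (ewens_mean_markov theta_gt0 (i := i) (g := fun _ v => v%:R / (N.+1%:R + theta)))//.
apply: eq_ewens_mean => s; rewrite /old_ratio /=.
have := natD_theta_gt0 theta_gt0 N; have := natD_theta_gt0 theta_gt0 N.+1.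
by rewrite -!natr1 => h1 h2; field; lra.
Qed.

(** One step of the chain adds to the mean square the conditional variance of
the increment, which is [x * (1 - x) / (N + 1 + theta)^2]. *)
Lemma mean_old_ratio_dist N n i : (i <= n <= N)%N ->
  E (fun s : 'S_N => (old_ratio s N i - old_ratio s n i) ^+ 2) <=
    (N - n)%:R / n.+1%:R ^+ 2.
Proof.
elim: N => [|N IH] /andP[i_n].
  rewrite leqn0 => /eqP ->; rewrite subnn mul0r -[leRHS](ewens_mean_cst theta_gt0 0).
  by apply: le_ewens_mean => // s; rewrite subrr expr0n.
rewrite leq_eqVlt => /predU1P[<-|].
  rewrite subnn mul0r -[leRHS](ewens_mean_cst theta_gt0 n).
  by apply: le_ewens_mean => // s; rewrite subrr expr0n.
rewrite ltnS => nN; have iN := leq_trans i_n nN.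
pose g (s : 'S_N) v := (v%:R / (N.+1%:R + theta) - old_ratio s n i) ^+ 2.
rewrite (ewens_mean_markov theta_gt0 (i := i) (g := g))//; last first.
  move=> s k; rewrite /g /old_ratio.
  by rewrite (old_count_removed (insert_max_removed s k) iN nN).
rewrite subSn// -natr1 mulrDl mul1r.
apply: le_trans (lerD (IH _) (lexx _)); last by rewrite i_n.
rewrite -[in leRHS](ewens_mean_cst theta_gt0 N (n.+1%:R ^- 2)) -ewens_meanD.
apply: le_ewens_mean => // s; rewrite /g /old_ratio.
set a := _ / (n%:R + theta); set v := old_count s N i.
have N0 := natD_theta_gt0 theta_gt0 N; have N1 := natD_theta_gt0 theta_gt0 N.+1.
set x := v%:R / (N%:R + theta); set d := (N.+1%:R + theta)^-1.
have x01 : 0 <= x <= 1.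
  rewrite divr_ge0 ?(ltW N0)//= ler_pdivrMr// mul1r ler_wpDr ?(ltW theta_gt0)//.
  by rewrite ler_nat old_count_le.
have -> : v%:R / (N.+1%:R + theta) = x - x * d.
  rewrite /x /d -natr1 in N1 *; field; lra.
have -> : v.+1%:R / (N.+1%:R + theta) = x + (1 - x) * d.
  rewrite /x /d; move: N1; rewrite -!natr1 => N1; field; lra.
have -> : x * (x + (1 - x) * d - a) ^+ 2 + (1 - x) * (x - x * d - a) ^+ 2 =
  (x - a) ^+ 2 + x * (1 - x) * d ^+ 2 by ring.
rewrite lerD2l -exprVn; apply: (@le_trans _ _ (d ^+ 2)).
  rewrite -[leRHS]mul1r ler_wpM2r ?sqr_ge0//; nra.
have d0 : 0 <= d by rewrite invr_ge0 ltW.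
rewrite ler_pXn2r ?nnegrE ?invr_ge0 ?ler0n ?(ltW N1)//.
rewrite lef_pV2 ?posrE ?ltr0n// ler_wpDr ?(ltW theta_gt0)//.
by rewrite ler_nat ltnS.
Qed.

(** The probability is the product of [j / (j + theta)] for [i <= j < N]; bounding
its inverse, a product of [1 + theta / j], from below by one plus the sum of the
[theta / j] is enough. *)
Lemma mean_all_old N i : (0 < i <= N)%N ->
  E (fun s : 'S_N => (old_count s N i == N)%:R) *
    (1 + theta * \sum_(i <= j < N) j%:R^-1) <= 1.
Proof.
elim: N => [|N IH] /andP[i0].
  by rewrite leqn0 => /eqP e; rewrite e in i0.
rewrite leq_eqVlt => /predU1P[e|].
  rewrite e big_geq// mulr0 addr0 mulr1 -[leRHS](ewens_mean_cst theta_gt0 N.+1).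
  by apply: le_ewens_mean => // s; rewrite lern1 leq_b1.
rewrite ltnS => iN; have N0 : 0 < N%:R :> R by rewrite ltr0n (leq_trans i0).
rewrite big_nat_recr//=.
have -> : E (fun s : 'S_N.+1 => (old_count s N.+1 i == N.+1)%:R) =
    N%:R / (N%:R + theta) * E (fun s : 'S_N => (old_count s N i == N)%:R).
  rewrite (ewens_mean_markov theta_gt0 (i := i) (g := fun _ v => (v == N.+1)%:R))//.
  rewrite -ewens_meanZ; apply: eq_ewens_mean => s /=.
  rewrite eqSS; case: (eqVneq (old_count s N i) N) => [->|].
    by rewrite (ltn_eqF (ltnSn N)) mulr0 addr0.
  rewrite (ltn_eqF (leq_ltn_trans (old_count_le _ _) (ltnSn N))).
  by rewrite !mulr0 addr0.
set p := E _; set H := \sum_(_ <= _ < _) _ in IH *.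
have p0 : 0 <= p by apply: ewens_mean_ge0.
have H0 : 0 <= H by apply: sumr_ge0 => j _; rewrite invr_ge0.
apply: le_trans (IH _); last by rewrite i0.
rewrite mulrAC -/p mulrC ler_wpM2l//.
have Nt := natD_theta_gt0 theta_gt0 N.
rewrite mulrAC ler_pdivrMr// -subr_ge0.
have -> : (1 + theta * H) * (N%:R + theta) - N%:R * (1 + theta * (H + N%:R^-1)) =
  theta ^+ 2 * H by field; lra.
by rewrite mulr_ge0// sqr_ge0.
Qed.

End moments.

(** * Deterministic facts for the passage to the limit *)

Lemma old_count_vperm (v : virtual_permutation) n N i : (i <= n <= N)%N ->
  old_count (v N) n i = old_count (v n) n i.
Proof.
elim: N => [|N IH] /andP[i_n]; first by rewrite leqn0 => /eqP ->.
rewrite leq_eqVlt => /predU1P[->//|]; rewrite ltnS => nN.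
by rewrite (old_count_removed (@vpermP v N) (leq_trans i_n nN) nN) IH// i_n.
Qed.

Lemma old_count_vpermS (v : virtual_permutation) N i : (i <= N)%N ->
  exists b : bool, old_count (v N.+1) N.+1 i = (old_count (v N) N i + b)%N.
Proof.
move=> iN; have [s [k sk]] := insert_maxP (v N.+1).
exists (touches (v N.+1) i ord_max); rewrite {1}sk old_count_recr// -sk.
congr (_ + _)%N; rewrite -(old_count_removed (@vpermP v N))// sk.
by rewrite (old_count_removed (insert_max_removed s k)).
Qed.

Section sequences.
Variable R : realType.

(** By induction on the sharper bound [2 - 1 / (n + 1)], which telescopes. *)
Lemma sum_inv_sqr_le (n : nat) : \sum_(0 <= k < n) k.+1%:R ^- 2 <= 2 :> R.
Proof.
case: n => [|n]; first by rewrite big_nil.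
suff : \sum_(0 <= k < n.+1) k.+1%:R ^- 2 <= 2 - n.+1%:R^-1 :> R.
  by move=> /le_trans; apply; rewrite lerBlDr lerDl.
elim: n => [|n IH].
  rewrite big_nat1 invr1 expr1n invr1; lra.
rewrite big_nat_recr//=; apply: le_trans (lerD IH (lexx _)) _.
have n0 : 0 < n.+1%:R :> R by [].
rewrite -[n.+2%:R]natr1 -subr_ge0; move: n0; move: (n.+1%:R : R) => x x0.
have -> : 2 - (x + 1)^-1 - (2 - x^-1 + (x + 1) ^- 2) = x^-1 * (x + 1) ^- 2.
  by field; lra.
by rewrite mulr_ge0// ?invr_ge0 ?sqr_ge0// ltW.
Qed.

(** Between the cubes of [m] and [m + 1] there are at most [7 * m^2] steps, each
of size at most [m^-3], so the sequence oscillates by [O(1 / m)] there. The shift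
by [i] keeps the first cube above [i]. *)
Lemma cvg_of_cubes (i : nat) (x : nat -> R) :
  (forall N, (i <= N)%N -> `|x N.+1 - x N| <= N.+1%:R^-1) ->
  cvgn (fun k => x ((k + i).+1 ^ 3)%N) -> cvgn x.
Proof.
move=> xS /cvg_ex[l /cvgrPdist_lt xl]; apply/cvg_ex; exists l.
pose a k := ((k + i).+1 ^ 3)%N.
have a_ge k : (i <= a k)%N by rewrite /a expnS; nia.
have dist k j : `|x (a k + j)%N - x (a k)| <= j%:R / (a k)%:R.
  elim: j => [|j IH]; first by rewrite addn0 subrr normr0 mul0r.
  rewrite addnS -(subrK (x (a k + j)%N) (x _.+1)) -addrA.
  apply: le_trans (ler_normD _ _) _; rewrite -natr1 mulrDl [leRHS]addrC lerD//.
  apply: le_trans (xS _ _) _; first by rewrite (leq_trans (a_ge k)) ?leq_addr.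
  rewrite mul1r lef_pV2 ?posrE ?ltr0n ?expn_gt0// ler_nat.
  by rewrite (leq_trans (leq_addr j _)).
have gap k : (a k.+1 <= a k + 7 * (k + i).+1 ^ 2)%N by rewrite /a addSn; nia.
apply/cvgrPdist_lt => e e0.
have [K _ xK] := xl (e / 2) ltac:(by rewrite divr_gt0).
have e14 : 0 < e / 14 by rewrite divr_gt0.
have [m mK] : exists m, forall k, (m <= k)%N -> 7 / k.+1%:R < e / 2.
  exists (Num.truncn (14 / e)) => k mk.
  have : 14 / e < k.+1%:R by apply: lt_le_trans (truncnS_gt _) _; rewrite ler_nat ltnS.
  by rewrite !ltr_pdivrMr// => h; lra.
pose K0 := maxn K m; near=> N.
have KN : (a K0 <= N)%N by near: N; exists (a K0).
have aN k : (a k <= N)%N -> (k <= N)%N.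
  by apply: leq_trans; rewrite /a expnS; nia.
have [k akN kmax] := ex_maxnP (ex_intro (fun k => a k <= N)%N _ KN) aN.
have Nk : (N < a k.+1)%N by rewrite ltnNge; apply/negP => /kmax; rewrite ltnn.
have K0k := kmax _ KN.
have ak0 : 0 < (a k)%:R :> R by rewrite ltr0n expn_gt0.
rewrite -(subrK (x (a k)) l) -addrA (le_lt_trans (ler_normD _ _))//.
rewrite (splitr e) ltrD ?xK//=; first by rewrite (leq_trans (leq_maxl _ _) K0k).
rewrite distrC -(subnKC akN); apply: le_lt_trans (dist _ _) _.
apply: le_lt_trans (mK k _); last by rewrite (leq_trans (leq_maxr _ _) K0k).
rewrite ler_pdivrMr// mulrAC ler_pdivlMr// -!natrM ler_nat.
have := gap k; rewrite /a in akN Nk *; move: akN Nk; move: (a k.+1) => A.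
rewrite [((k + i).+1 ^ 3)%N]expnS; set q := ((k + i).+1 ^ 2)%N => akN Nk Aq.
have : (N - (k + i).+1 * q <= 7 * q)%N by lia.
nia.
Unshelve. all: by end_near. Qed.

End sequences.

(** * From marginal laws to almost sure statements *)

Section probability.
Context d (Omega : measurableType d) (R : realType) (P : probability Omega R).

(** The sum of the series has a finite mean, hence is almost surely finite. *)
Lemma ae_cvg_series (g : nat -> Omega -> R) (c : nat -> R) C :
  (forall k, measurable_fun setT (g k)) -> (forall k w, 0 <= g k w) ->
  (forall k, (\int[P]_w (g k w)%:E <= (c k)%:E)%E) ->
  (forall n, \sum_(0 <= k < n) c k <= C) ->
  {ae P, forall w, cvgn (series (g ^~ w))}.
Proof.
move=> mg g0 gc cC.
have mG k : measurable_fun setT (fun w => (g k w)%:E) by exact/measurable_EFinP.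
have mS : measurable_fun setT (fun w => \sum_(k <oo) (g k w)%:E : \bar R)%E.
  rewrite (_ : (fun w => _) = fun w => (\sum_(0 <= k <oo | k \in xpredT) (g k w)%:E)%E).
    by apply: ge0_emeasurable_sum => // k w _ _; rewrite lee_fin.
  by apply/funext => w; apply: eq_eseriesl.
have S0 w : (0 <= \sum_(k <oo) (g k w)%:E)%E.
  by apply: nneseries_ge0 => k _ _; rewrite lee_fin.
have fin : (\int[P]_w (\sum_(k <oo) (g k w)%:E) <= C%:E)%E.
  rewrite integral_nneseries//; last by move=> k w _; rewrite lee_fin.
  apply: lime_le.
    by apply: is_cvg_nneseries => k _ _; apply: integral_ge0 => w _; rewrite lee_fin.
  apply: nearW => n; apply: le_trans (_ : (_ <= \sum_(0 <= k < n) (c k)%:E)%E) _.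
    by apply: lee_sum => k _.
  by rewrite sumEFin lee_fin.
have : P.-integrable setT (fun w => \sum_(k <oo) (g k w)%:E)%E.
  apply/integrableP; split => //; under eq_integral do rewrite gee0_abs//.
  exact: le_lt_trans fin (ltry _).
move=> /(integrable_ae measurableT); apply: filterS => w /(_ I) wfin.
apply: nondecreasing_is_cvgn; first by apply: nondecreasing_series => k _ _.
exists (fine (\sum_(k <oo) (g k w)%:E)%E) => _ [n _ <-].
rewrite -lee_fin fineK// /series/= -sumEFin.
by apply: nneseries_lim_ge => k _ _; rewrite lee_fin.
Qed.

(** By Fatou's lemma the nonnegative lower limit has mean zero. *)
Lemma ae_liminf_eq0 (g : nat -> Omega -> \bar R) (e : nat -> R) :
  (forall k, measurable_fun setT (g k)) -> (forall k w, (0 <= g k w)%E) ->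
  (forall k, (\int[P]_w g k w <= (e k)%:E)%E) -> e @ \oo --> 0 ->
  {ae P, forall w, limn_einf (g ^~ w) = 0%E}.
Proof.
move=> mg g0 ge e0.
have eE0 : EFin \o e @ \oo --> 0%E by apply: cvg_EFin; first exact: nearW.
have einf0 w : (0 <= limn_einf (g ^~ w))%E.
  rewrite limn_einf_lim; apply: lime_ge; first exact: is_cvg_einfs.
  by apply: nearW => n; apply: le_ereal_inf_tmp => _ [m _ <-].
have meinf : measurable_fun setT (fun w => limn_einf (g ^~ w)).
  rewrite /limn_einf; apply: measurableT_comp => //.
  by apply: measurable_fun_limn_esup => k; exact: measurableT_comp.
have : (\int[P]_w `|limn_einf (g ^~ w)| = 0)%E.
  apply/eqP; rewrite eq_le integral_ge0// andbT.
  under eq_integral do rewrite gee0_abs//.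
  apply: le_trans (fatou _ _ _ _) _ => //.
  rewrite limn_einf_lim; have -> : (0 = limn (EFin \o e))%E.
    by apply/esym/cvg_lim.
  apply: lee_lim; [exact: is_cvg_einfs|by apply/cvg_ex; exists 0%E|].
  apply: nearW => n; apply: le_trans (ge n); apply: ereal_inf_lbound.
  by exists n => /=.
move=> /(ae_eq_integral_abs P measurableT meinf).
by apply: filterS => w /(_ I).
Qed.

End probability.

Section marginals.
Context d (Omega : measurableType d) (R : realType) (P : probability Omega R).
Variables (theta : R) (sigma : Omega -> virtual_permutation).
Hypothesis theta_gt0 : 0 < theta.
Hypothesis sigma_ewens : ewens_distributed P theta sigma.

Lemma vperm_sumE N (h : 'S_N -> R) w :
  h (sigma w N) = \sum_s h s * \1_[set w | sigma w N = s] w.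
Proof.
rewrite (bigD1 (sigma w N))//= indicE mem_set// mulr1 big1 ?addr0// => s sN.
by rewrite indicE memNset ?mulr0// => /= e; rewrite e eqxx in sN.
Qed.

Lemma measurable_vperm N (h : 'S_N -> R) :
  measurable_fun setT (fun w => h (sigma w N)).
Proof.
under eq_fun do rewrite vperm_sumE.
apply: measurable_sum => s; apply: measurable_funM => //.
by apply: measurable_indic; case: (sigma_ewens s).
Qed.

Lemma integral_vperm N (h : 'S_N -> R) : (forall s, 0 <= h s) ->
  (\int[P]_w (h (sigma w N))%:E = (ewens_mean theta h)%:E)%E.
Proof.
move=> h0; under eq_integral do rewrite vperm_sumE -sumEFin.
have mA s : measurable [set w | sigma w N = s] by case: (sigma_ewens s).
rewrite ge0_integral_sum//; first last.
- by move=> s w _; rewrite lee_fin mulr_ge0.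
- move=> s; apply/measurable_EFinP; apply: measurable_funM => //.
rewrite /ewens_mean -sumEFin; apply: eq_bigr => s _.
under eq_integral do rewrite EFinM.
rewrite ge0_integralZl ?lee_fin//; last first.
  by apply/measurable_EFinP; exact: measurable_indic.
by rewrite integral_indic// setIT EFinM; congr (_ * _)%E; case: (sigma_ewens s).
Qed.

Lemma probability_vperm N (b : 'S_N -> bool) :
  measurable [set w | b (sigma w N)] /\
  P [set w | b (sigma w N)] = (ewens_mean theta (fun s => (b s)%:R))%:E.
Proof.
have mb : measurable [set w | b (sigma w N)].
  have := measurable_vperm (fun s => (b s)%:R) measurableT (measurable_set1 1).
  rewrite setTI; congr (measurable _); apply/seteqP; split => w /=.
    by case: (b _) => // /eqP; rewrite eq_sym oner_eq0.
  by move=> ->.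
split => //; rewrite -integral_vperm// -[in LHS](setIT [set w | _]) -integral_indic//.
apply: eq_integral => w _; rewrite indicE; have [h|/negP h] := boolP (b (sigma w N)).
  by rewrite mem_set.
by rewrite memNset.
Qed.

Lemma old_ratio_le1 N (s : 'S_N) i : old_ratio theta s N i <= 1.
Proof.
rewrite ler_pdivrMr ?natD_theta_gt0// mul1r ler_wpDr ?(ltW theta_gt0)//.
by rewrite ler_nat old_count_le.
Qed.

Lemma old_ratioS (v : virtual_permutation) N i : (i <= N)%N ->
  `|old_ratio theta (v N.+1) N.+1 i - old_ratio theta (v N) N i| <= N.+1%:R^-1.
Proof.
move=> iN; have [b vb] := old_count_vpermS v iN.
rewrite /old_ratio vb; have := old_count_le (v N) i; rewrite -(ler_nat R).
set V := (old_count _ _ _).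
have Nt := natD_theta_gt0 theta_gt0 N.
rewrite natrD -natr1;
  move: (V%:R : R) (ler0n R V) (N%:R : R) (ler0n R N) Nt => {vb V} V V0 n n0 nt Vn.
have b01 : 0 <= (b%:R : R) <= 1 by rewrite ler0n lern1 leq_b1.
move: (b%:R : R) b01 => {}b b01.
have n1 : 0 < n + 1 by lra.
have -> : (V + b) / (n + 1 + theta) - V / (n + theta) =
   (b * (n + theta) - V) / (n + theta) / (n + 1 + theta) by field; lra.
rewrite !normrM !normfV (gtr0_norm nt) (gtr0_norm (_ : 0 < n + 1 + theta)); last lra.
have t0 := theta_gt0.
have zn : `|b * (n + theta) - V| <= n + theta.
  have b0 : 0 <= b * (n + theta) by apply: mulr_ge0; lra.
  have b1 : b * (n + theta) <= n + theta by apply: ler_piMl; lra.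
  by rewrite ler_norml; apply/andP; split; lra.
apply: (@le_trans _ _ (n + 1 + theta)^-1); last first.
  by rewrite lef_pV2 ?posrE; lra.
rewrite -[leRHS]mul1r; apply: ler_wpM2r; first by rewrite invr_ge0; lra.
by rewrite ler_pdivrMr// mul1r.
Qed.

(** The second moment of the increment is [O(m^-4)], since it spans [O(m^2)] steps
beyond [m^3]. The weight [m^2] in the inequality [|z| <= m^-2 + m^2 * z^2]
balances the two terms. *)
Lemma mean_old_ratio_incr i m : (i < m)%N ->
  ewens_mean theta (fun s : 'S_(m.+1 ^ 3) =>
    `|old_ratio theta s (m.+1 ^ 3) i - old_ratio theta s (m ^ 3) i|) <=
  8 * m%:R ^- 2.
Proof.
move=> im; have m0 : 0 < m%:R :> R by rewrite ltr0n (leq_ltn_trans _ im).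
have young (z : R) : `|z| <= m%:R ^- 2 + m%:R ^+ 2 * z ^+ 2.
  have := sqr_ge0 (m%:R^-1 - m%:R * `|z|); rewrite sqrrB mulrA mulVf ?gt_eqF//.
  rewrite mul1r exprMn real_normK ?num_real// exprVn mulr2n => h.
  have := normr_ge0 z; lra.
apply: le_trans (le_ewens_mean theta_gt0 (fun s => young _)) _.
rewrite ewens_meanD ewens_mean_cst// ewens_meanZ.
suff : m%:R ^+ 2 * (((m.+1 ^ 3) - (m ^ 3))%:R / (m ^ 3).+1%:R ^+ 2) <= 7 * m%:R ^- 2 :> R.
  move=> h; have := @mean_old_ratio_dist R theta theta_gt0 (m.+1 ^ 3) (m ^ 3) i.
  move=> /(_ _)/(ler_wpM2l (sqr_ge0 m%:R)) H.
  have : (i <= m ^ 3 <= m.+1 ^ 3)%N.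
    by rewrite leq_exp2r// leqnSn andbT expnS; nia.
  move=> /H/le_trans/(_ h) {}H; lra.
apply: (@le_trans _ _ (m%:R ^+ 2 * ((7 * m%:R ^+ 2) / (m%:R ^+ 3) ^+ 2))).
  apply: ler_wpM2l; first exact: sqr_ge0.
  apply: ler_pM => //.
  - by rewrite -natrX -natrM ler_nat; nia.
  - rewrite lef_pV2 ?posrE ?exprn_gt0// ler_pXn2r ?nnegrE// ?exprn_ge0//.
    by rewrite -natrX ler_nat leqnSn.
by rewrite le_eqVlt; apply/predU1P; left; field; lra.
Qed.

Lemma ae_cvg_old_ratio i :
  {ae P, forall w, cvgn (fun N => old_ratio theta (sigma w N) N i)}.
Proof.
pose a k := ((k + i).+1 ^ 3)%N.
pose h k (s : 'S_(a k.+1)) :=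
  `|old_ratio theta s (a k.+1) i - old_ratio theta s (a k) i|.
have : {ae P, forall w, cvgn (series (fun k => h k (sigma w (a k.+1))))}.
  apply: (@ae_cvg_series _ _ _ _ (fun k w => h k (sigma w (a k.+1)))
    (fun k => 8 * k.+1%:R ^- 2) 16).
  - by move=> k; exact: measurable_vperm.
  - by move=> k w; exact: normr_ge0.
  - move=> k; rewrite integral_vperm ?lee_fin; last by move=> s; exact: normr_ge0.
    apply: le_trans (mean_old_ratio_incr (m := (k + i).+1) _) _; first by rewrite ltnS leq_addl.
    rewrite ler_pM2l// lef_pV2 ?posrE ?exprn_gt0// ler_pXn2r ?nnegrE//.
    by rewrite ler_nat ltnS leq_addr.
  - move=> n; rewrite -mulr_sumr; have := sum_inv_sqr_le R n; lra.
apply: filterS => w sw; apply: (@cvg_of_cubes _ i); first by move=> N iN; exact: old_ratioS.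
set x := fun k => _; have -> : x = fun n => x 0%N + series (telescope x) n.
  by apply/funext => n; rewrite -eq_sum_telescope.
apply: is_cvgD; first exact: is_cvg_cst.
apply: normed_cvg; rewrite (_ : [normed series _] =
  series (fun k => h k (sigma w (a k.+1))))//.
apply/funext => n; apply: eq_bigr => k _; rewrite /h /telescope /x /=.
rewrite /old_ratio (old_count_vperm (sigma w) (n := a k))//.
by rewrite leq_exp2r// addSn leqnSn andbT /a expnS; nia.
Qed.

(** The inner lower limit has mean at most [theta / (i + theta)], by Fatou's lemma in
[N]; the outer one is then treated by the same lemma in [i]. *)
Lemma ae_old_ratio_exhaust :
  {ae P, forall w, limn_einf (fun i =>
    limn_einf (fun N => (1 - old_ratio theta (sigma w N) N i)%:E)) = 0%E}.
Proof.
have ge0 N i w : (0 <= (1 - old_ratio theta (sigma w N) N i)%:E)%E.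
  by rewrite lee_fin subr_ge0 old_ratio_le1.
have mX N i : measurable_fun setT (fun w => (1 - old_ratio theta (sigma w N) N i)%:E).
  by apply/measurable_EFinP; exact: (measurable_vperm (fun s => 1 - old_ratio theta s N i)).
apply: (@ae_liminf_eq0 _ _ _ _
  (fun i w => limn_einf (fun N => (1 - old_ratio theta (sigma w N) N i)%:E))
  (fun i => theta / (i%:R + theta))).
- move=> i; rewrite /limn_einf; apply: measurableT_comp => //.
  by apply: measurable_fun_limn_esup => k; exact: measurableT_comp.
- move=> i w; rewrite limn_einf_lim; apply: lime_ge; first exact: is_cvg_einfs.
  by apply: nearW => n; apply: le_ereal_inf_tmp => _ [m _ <-].
- move=> i; apply: le_trans (fatou _ _ _ _) _ => //.
  rewrite limn_einf_lim; apply: lime_le; first exact: is_cvg_einfs.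
  apply: nearW => n; apply: (@le_trans _ _
    (\int[P]_w (1 - old_ratio theta (sigma w (n + i)) (n + i) i)%:E)%E).
    by apply: ereal_inf_lbound; exists (n + i)%N => //=; rewrite leq_addr.
  rewrite (integral_vperm (h := fun s => 1 - old_ratio theta s (n + i) i)); last first.
    by move=> s; rewrite subr_ge0 old_ratio_le1.
  rewrite lee_fin; under eq_ewens_mean do rewrite -mulN1r.
  rewrite ewens_meanD ewens_meanZ ewens_mean_cst// mean_old_ratio ?leq_addl//.
  by have := natD_theta_gt0 theta_gt0 i => i0; rewrite le_eqVlt; apply/predU1P; left; field; lra.
- rewrite -[0](mulr0 theta); apply: cvgMr.
  apply/cvgrPdist_lt => e e0; near=> n.
  rewrite sub0r normrN gtr0_norm ?invr_gt0 ?natD_theta_gt0//.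
  rewrite invf_plt ?posrE ?natD_theta_gt0// ltr_wpDr ?(ltW theta_gt0)//.
  by near: n; exact: nbhs_infty_gtr.
Unshelve. all: by end_near. Qed.

Lemma harmonic_tail_unbounded i (A : R) : (0 < i)%N ->
  exists2 N, (i <= N)%N & A < \sum_(i <= j < N) j%:R^-1.
Proof.
case: i => // i _.
have /cvgryPgt/(_ (A + series harmonic i)) : series (@harmonic R) @ \oo --> +oo.
  apply: nondecreasing_dvgn_lt; last exact: dvg_harmonic.
  by apply: nondecreasing_series => n _ _; exact: harmonic_ge0.
move=> [n _ hn]; exists (maxn i n).+1; first by rewrite ltnS leq_maxl.
have := hn _ (leq_maxr i n); rewrite -ltrBrDr => /lt_le_trans; apply.
by rewrite big_add1 /= sub_series_geq ?leq_maxl.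
Qed.

(** The exceptional event is contained in [V_N i = N] for every [N], whose
probability is arbitrarily small. *)
Lemma ae_new_cycle i : (0 < i)%N ->
  {ae P, forall w, exists N, (old_count (sigma w N) N i < N)%N}.
Proof.
move=> i0; pose A N := [set w | old_count (sigma w N) N i == N].
have mA N : measurable (A N) by case: (probability_vperm (fun s : 'S_N => old_count s N i == N)).
exists (\bigcap_N A N); split; first exact: bigcapT_measurable.
- apply/eqP; rewrite eq_le measure_ge0 andbT; apply/lee_addgt0Pr => e e0.
  rewrite add0e.
  have [N iN HN] : exists2 N, (i <= N)%N & (theta * e)^-1 < \sum_(i <= j < N) j%:R^-1.
    exact: harmonic_tail_unbounded.
  apply: (@le_trans _ _ (P (A N))).
    by apply: le_measure; rewrite ?inE//; [exact: bigcapT_measurable|exact: bigcap_inf].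
  have [_ ->] := probability_vperm (fun s : 'S_N => old_count s N i == N).
  have := @mean_all_old R theta theta_gt0 N i; rewrite i0 iN => /(_ isT).
  have HN1 : e^-1 <= 1 + theta * \sum_(i <= j < N) j%:R^-1.
    move: HN; rewrite invfM mulrC ltr_pdivrMr// mulrC => /ltW/le_trans; apply.
    by rewrite lerDr.
  have H0 := lt_le_trans (_ : 0 < e^-1) HN1.
  rewrite lee_fin -ler_pdivlMr ?H0 ?invr_gt0// div1r => /le_trans; apply.
  by rewrite invf_ple ?posrE ?H0 ?invr_gt0.
- move=> w /= nw N _; apply/negPn/negP => h; apply: nw; exists N.
  by rewrite ltn_neqAle h old_count_le.
Qed.

End marginals.

(** * Regular growth *)

Definition old_freq {R : realType} (v : virtual_permutation) (i N : nat) : R :=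
  (old_count (v N) N i)%:R / N%:R.

(** The almost sure properties of an Ewens virtual permutation that the convergence of
the eigenangles rests on: proportions converge, no mass escapes to cycles born
late, and new cycles keep appearing. *)
Definition regular_growth (R : realType) (v : virtual_permutation) : Prop :=
  [/\ forall i, cvgn (@old_freq R v i),
      forall e : R, 0 < e -> exists i, 1 - e < limn (@old_freq R v i) &
      forall i, exists N, (old_count (v N) N i < N)%N].

Section regular_growth.
Context d (Omega : measurableType d) (R : realType) (P : probability Omega R).
Variables (theta : R) (sigma : Omega -> virtual_permutation).
Hypothesis theta_gt0 : 0 < theta.
Hypothesis sigma_ewens : ewens_distributed P theta sigma.

(** The two normalizations differ by the factor [1 + theta / N], also at [N = 0]
where both ratios vanish. *)
Lemma cvg_old_freq (v : virtual_permutation) i (l : R) :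
  (fun N => old_ratio theta (v N) N i) @ \oo --> l -> old_freq v i @ \oo --> l.
Proof.
move=> vl; have -> : old_freq v i = fun N => old_ratio theta (v N) N i * (1 + theta * N%:R^-1).
  apply/funext => N; rewrite /old_freq /old_ratio; case: N => [|N].
    by have := old_count_le (v 0%N) i; rewrite leqn0 => /eqP ->; rewrite !mul0r.
  have : 0 < N.+1%:R :> R by []; have := natD_theta_gt0 theta_gt0 N.+1.
  by move: (N.+1%:R : R) ((old_count _ _ _)%:R : R) => n V nt n0; field; lra.
rewrite -[l]mulr1; apply: cvgM => //; rewrite -[X in _ --> X]addr0.
apply: cvgD; first exact: cvg_cst.
rewrite -(mulr0 theta); apply: cvgMr.
by rewrite -cvg_shiftS; exact: cvg_harmonic.
Qed.

Lemma ae_regular_growth : {ae P, forall w, regular_growth R (sigma w)}.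
Proof.
have A1 : {ae P, forall w i, cvgn (fun N => old_ratio theta (sigma w N) N i)}.
  by apply: ae_foralln => i; exact: ae_cvg_old_ratio.
have A2 := ae_old_ratio_exhaust theta_gt0 sigma_ewens.
have A3 : {ae P, forall w i, exists N, (old_count (sigma w N) N i.+1 < N)%N}.
  by apply: ae_foralln => i; exact: (ae_new_cycle theta_gt0 sigma_ewens).
apply: filterS3 A1 A2 A3 => w cX inf0 new.
have freq i := cvg_old_freq (cX i).
split.
- by move=> i; apply/cvg_ex; eexists; exact: freq.
- move=> e e0; apply: contrapT => /forallNP h.
  suff : (e%:E <= 0)%E by rewrite lee_fin leNgt e0.
  rewrite -inf0 limn_einf_lim; apply: lime_ge; first exact: is_cvg_einfs.
  apply: nearW => n; apply: le_ereal_inf_tmp => _ [i _ <-].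
  have c1 : (fun N => (1 - old_ratio theta (sigma w N) N i)%:E) @ \oo -->
      (1 - limn (fun N => old_ratio theta (sigma w N) N i))%:E.
    apply: cvg_EFin; first exact: nearW.
    by apply: cvgB; [exact: cvg_cst|exact: cX].
  rewrite (cvg_limn_einf_sup c1).1 lee_fin.
  have := h i; rewrite (cvg_lim (@Rhausdorff R) (freq i)).
  by move/negP; rewrite -leNgt; lra.
- move=> i; have [N hN] := new i; exists N; apply: leq_ltn_trans hN.
  exact: old_count_mono.
Qed.

End regular_growth.

(** * The blocks of a virtual permutation *)

(** An element whose cycle meets [{0, ..., j}] but not [{0, ..., j-1}] lies in
the cycle of [j], and [j] is then the smallest element of this cycle. *)
Lemma old_countS N (s : 'S_N) (j : 'I_N) :
  old_count s N j.+1 = (old_count s N j + (if cycle_min s j then #|porbit s j| else 0))%N.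
Proof.
have tS k : touches s j.+1 k = touches s j k || (j \in porbit s k).
  apply/existsP/orP => [[l /andP[]]|[/existsP[l /andP[lj lk]]|jk]].
  - rewrite ltnS leq_eqVlt => /predU1P[/val_inj ->|lj] lk; first by right.
    by left; apply/existsP; exists l; rewrite lj.
  - by exists l; rewrite lk ltnS ltnW.
  - by exists j; rewrite jk ltnS leqnn.
rewrite -!card_touches; case: ifPn => [|/negPn] mj.
  have <- := cardUI [pred k | touches s j k] (mem (porbit s j)).
  rewrite [X in (_ = _ + X)%N](eq_card0 (A := predI _ _)); last first.
    move=> k; rewrite !inE; apply/negP => /andP[/existsP[l /andP[lj lk]] kj].
    move/negP: mj; apply; apply/existsP; exists l; rewrite lj /=.
    by move: kj lk; rewrite -!eq_porbit_mem => /eqP <-.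
  by rewrite addn0; apply: eq_card => k; rewrite !inE tS porbit_sym.
rewrite addn0; apply: eq_card => k; rewrite !inE tS.
apply/orb_idr; rewrite -eq_porbit_mem => /eqP e.
by move: mj; rewrite /touches e.
Qed.

Section blocks.
Variable v : virtual_permutation.

Lemma porbit_vperm n N (h : (n <= N)%N) (j k : 'I_n) :
  (widen_ord h k \in porbit (v N) (widen_ord h j)) = (k \in porbit (v n) j).
Proof.
elim: N h => [|N IH] h.
  by case: n h j k => // h [].
have [e|nN] := eqVneq n N.+1.
  subst n.
  by congr (_ \in porbit _ _); apply: val_inj.
have h' : (n <= N)%N by rewrite -ltnS ltn_neqAle nN.
rewrite -(IH h') -(porbit_last_removed (@vpermP v N)).
by congr (_ \in porbit _ _); apply: val_inj.
Qed.

Lemma touches_vperm n N i (h : (n <= N)%N) (j : 'I_n) : (i <= n)%N ->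
  touches (v N) i (widen_ord h j) = touches (v n) i j.
Proof.
move=> i_n; apply/existsP/existsP => -[k /andP[ki kj]]; last first.
  by exists (widen_ord h k); rewrite porbit_vperm ki.
exists (Ordinal (leq_trans ki i_n)); rewrite /= ki -(porbit_vperm h).
by rewrite (_ : widen_ord h _ = k)//; apply: val_inj.
Qed.

(** Whether [i] is the smallest element of its cycle does not depend on the
permutation of the sequence in which it is looked at; the first one that contains
[i] is used here. *)
Definition vmin (i : nat) : bool := cycle_min (v i.+1) ord_max.

Lemma vminE N (j : 'I_N) : cycle_min (v N) j = vmin j.
Proof.
rewrite /vmin /cycle_min /= -(touches_vperm (ltn_ord j))//.
by congr (~~ touches _ _ _); apply: val_inj.
Qed.

(** The number of elements below [N] of the block with smallest element [i], with the
convention that it is zero when [i] is not the smallest element of its block. *)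
Definition cycle_size (i N : nat) : nat :=
  (old_count (v N) N i.+1 - old_count (v N) N i)%N.

Lemma cycle_sizeE N (j : 'I_N) :
  cycle_size j N = if vmin j then #|porbit (v N) j| else 0%N.
Proof. by rewrite /cycle_size old_countS addKn vminE. Qed.

Lemma cycle_size_out i N : (N <= i)%N -> cycle_size i N = 0%N.
Proof. by move=> Ni; rewrite /cycle_size !old_count_full ?subnn// ltnW. Qed.

Lemma cycle_size_nmin i N : ~~ vmin i -> cycle_size i N = 0%N.
Proof.
move=> mi; have [Ni|iN] := leqP N i; first exact: cycle_size_out.
by rewrite -[ i ]/(val (Ordinal iN)) cycle_sizeE /= (negbTE mi).
Qed.

Definition linked (a b : nat) : Prop :=
  exists N (j k : 'I_N), [/\ j = a :> nat, k = b :> nat & k \in porbit (v N) j].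

Lemma linkedP N (j k : 'I_N) : linked j k <-> k \in porbit (v N) j.
Proof.
split=> [[M [j' [k' [ej ek]]]]|jk]; last by exists N, j, k.
rewrite -(porbit_vperm (leq_maxl M N)) -(porbit_vperm (leq_maxr M N)).
by congr (is_true (_ \in porbit _ _)); apply: val_inj; rewrite /= (ej, ek).
Qed.

Lemma linked_lift a b : exists2 N, (a < N)%N & (b < N)%N.
Proof. by exists (maxn a b).+1; rewrite ltnS ?leq_maxl ?leq_maxr. Qed.

Lemma linked_refl a : linked a a.
Proof. by exists a.+1, ord_max, ord_max; rewrite porbit_id. Qed.

Lemma linked_sym a b : linked a b -> linked b a.
Proof. by move=> [N [j [k [ja kb jk]]]]; exists N, k, j; rewrite porbit_sym. Qed.

Lemma linked_trans b a c : linked a b -> linked b c -> linked a c.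
Proof.
have [N aN] := linked_lift a (maxn b c); rewrite gtn_max => /andP[bN cN].
move=> /(linkedP (Ordinal aN) (Ordinal bN)) + /(linkedP (Ordinal bN) (Ordinal cN)).
rewrite -!eq_porbit_mem => /eqP ba; rewrite ba eq_porbit_mem => ca.
exact/(linkedP (Ordinal aN) (Ordinal cN)).
Qed.

Definition block (a : nat) : set nat := [set b | linked a b].

Lemma eq_block a b : linked a b -> block a = block b.
Proof.
move=> ab; apply/seteqP; split => c /=; first exact/linked_trans/linked_sym.
exact: linked_trans.
Qed.

Lemma trace_block N (j : 'I_N) : trace (block j) N = porbit (v N) j.
Proof.
apply/setP => k; rewrite inE; apply/idP/idP => [|jk].
  by move=> /set_mem /linkedP.
by apply/mem_set/linkedP.
Qed.

Lemma infinite_cycle_block a : infinite_cycle v (block a).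
Proof.
split; first by exists a; exact: linked_refl.
move=> N /set0Pn[j]; rewrite inE => /set_mem aj.
by rewrite (eq_block aj) trace_block; apply/imsetP; exists j.
Qed.

(** Two elements of [C] are both visible in some [trace C N], which is a single
orbit. *)
Lemma infinite_cycleE C a : infinite_cycle v C -> C a -> C = block a.
Proof.
move=> [_ hC] Ca.
have key N (j : 'I_N) : C j -> trace C N = porbit (v N) j.
  move=> Cj; have jC : j \in trace C N by rewrite inE; exact: mem_set.
  have /imsetP[k _ e] := hC N (introT (set0Pn _) (ex_intro _ j jC)).
  by rewrite e; apply/eqP; rewrite eq_sym eq_porbit_mem -e.
apply/seteqP; split => b /=; have [N aN bN] := linked_lift a b.
  move=> Cb; apply/(linkedP (Ordinal aN) (Ordinal bN)).
  by rewrite -(key N (Ordinal aN))// inE; exact: mem_set.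
move=> /(linkedP (Ordinal aN) (Ordinal bN)).
by rewrite -(key N (Ordinal aN))// inE => /set_mem.
Qed.

Lemma smallest_block i : is_smallest (block i) i <-> vmin i.
Proof.
split=> [[_ h]|].
  apply/cycle_minP => k ki; apply: h.
  exact/(linkedP (ord_max : 'I_i.+1) k).
move=> mi; split; first exact: linked_refl.
move=> b /=; have [N iN bN] := linked_lift i b.
move=> /(linkedP (Ordinal iN) (Ordinal bN)).
have /cycle_minP : cycle_min (v N) (Ordinal iN) by rewrite vminE.
by move=> h /h.
Qed.

Lemma is_cycle_minE i : is_cycle_min v i <-> vmin i.
Proof.
split=> [[C hC [Ci mi]]|mi].
  by apply/smallest_block; rewrite -(infinite_cycleE hC Ci).
by exists (block i); [exact: infinite_cycle_block|exact/smallest_block].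
Qed.

Lemma card_trace_block i N : vmin i -> #|trace (block i) N| = cycle_size i N.
Proof.
move=> mi; have [Ni|iN] := leqP N i; last first.
  by rewrite -[ i ]/(val (Ordinal iN)) cycle_sizeE trace_block mi.
rewrite cycle_size_out//; apply: eq_card0 => j; rewrite inE; apply/negP.
move=> /set_mem; have [_ h] := (smallest_block i).2 mi => /h.
by rewrite leqNgt (leq_trans (ltn_ord j)).
Qed.

Definition min_count (i : nat) : nat := #|[pred j : 'I_i | vmin j]|.

Lemma min_countS i : min_count i.+1 = (min_count i + vmin i)%N.
Proof. by rewrite /min_count card_ord_recr. Qed.

Lemma min_count_mono i j : (i <= j)%N -> (min_count i <= min_count j)%N.
Proof.
elim: j => [|j IH]; first by rewrite leqn0 => /eqP ->.
by rewrite leq_eqVlt => /predU1P[->//|/IH/leq_trans]; apply; rewrite min_countS leq_addr.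
Qed.

Lemma min_count_inj i j : vmin i -> vmin j -> min_count i = min_count j -> i = j.
Proof.
wlog ij : i j / (i <= j)%N => [H|] mi mj e.
  by have [/H|/ltnW/H] := leqP i j; [apply|move=> ->].
apply/eqP; rewrite eqn_leq ij leqNgt; apply/negP => /min_count_mono.
by rewrite min_countS mi addn1 e ltnn.
Qed.

Hypothesis inf_min : forall i, exists2 j, (i <= j)%N & vmin j.

Lemma ex_min_count m : exists2 i, vmin i & min_count i = m.
Proof.
elim: m => [|m [i mi <-]].
  have [j0 _ mj0] := inf_min 0.
  have [i mi h] := ex_minnP (ex_intro (fun j => vmin j) j0 mj0).
  exists i => //; apply: eq_card0 => j; rewrite inE; apply/negbTE/negP => /(h _).
  by rewrite leqNgt ltn_ord.
have [j0 ij0 mj0] := inf_min i.+1.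
have ex0 : exists j, (i < j)%N && vmin j by exists j0; rewrite ij0.
have [j /andP[ij mj] h] := ex_minnP ex0.
exists j => //; rewrite -[RHS]addn1 -[1%N]/(nat_of_bool true) -[in RHS]mi -min_countS.
have: forall k, (i < k <= j)%N -> min_count k = min_count i.+1; last by apply; rewrite ij leqnn.
elim=> // k IH /andP[]; rewrite ltnS leq_eqVlt => /predU1P[->//|ik] kj.
rewrite min_countS IH ?ik ?(ltnW kj)//; case: (boolP (vmin k)) => [mk|]; last by rewrite addn0.
by have := h k; rewrite ik mk leqNgt kj => /(_ isT).
Qed.

(** The smallest elements of the successive blocks enumerate the cycle minima; this
turns the sums over [m] into sums over cycle minima, where no order of the blocks
is involved. *)
Lemma nth_cycle_enum : exists e : nat -> nat,
  [/\ forall m, vmin (e m) /\ nth_cycle v m = block (e m),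
      injective e & forall i, vmin i -> exists m, e m = i].
Proof.
have [e he] := choice (fun m => let: ex_intro2 i a b := ex_min_count m in
  ex_intro (fun i => vmin i /\ min_count i = m) i (conj a b)).
have cnt i : #|[pred j : 'I_i | `[< is_cycle_min v j >]]| = min_count i.
  by apply: eq_card => j; rewrite !inE; apply/asboolP/idP => /is_cycle_minE.
exists e; split.
- move=> m; have [mem em] := he m; split => //; rewrite /nth_cycle.
  case: xgetP => [C _ [hC [i si]]|/(_ (block (e m)))]; last first.
    case; split; first exact: infinite_cycle_block.
    by exists (e m); [exact/smallest_block|rewrite cnt].
  have mi : vmin i by apply/is_cycle_minE; exists C.
  rewrite cnt => im; rewrite -(min_count_inj mi mem (etrans im (esym em))).
  exact: infinite_cycleE hC si.1.
- by move=> m n emn; rewrite -(he m).2 emn (he n).2.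
- move=> i mi; exists (min_count i); have [a b] := he (min_count i).
  exact: min_count_inj.
Qed.

End blocks.

(** * The characteristic polynomial of a permutation matrix *)

Section charpoly.

(** The matrix [diag x - P_s]. Weights that vary with the row are needed for the
induction on the size, although only constant weights matter in the end. *)
Definition weighted_mx (R : nzRingType) N (x : 'I_N -> R) (s : 'S_N) : 'M[R]_N :=
  \matrix_(j, k) (x j *+ (j == k) - (j == s k)%:R).

Lemma insert_max_old N (s : 'S_N) k (j : 'I_N) :
  k != widenS j -> insert_max s k (widenS j) = widenS (s j).
Proof.
move=> kj; rewrite permM tpermD//; last by rewrite eq_sym widenS_neq_max.
by rewrite -lift_maxE lift_perm_lift lift_maxE.
Qed.

Lemma prod_porbit_insert (R : comNzRingType) N (x : 'I_N.+1 -> R) (s : 'S_N) k i :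
  \prod_(j in porbit (insert_max s k) (widenS i)) x j =
  (\prod_(j in porbit s i) x (widenS j)) *
  (if ord_max \in porbit (insert_max s k) (widenS i) then x ord_max else 1).
Proof.
rewrite big_mkcond big_ord_recr /=; congr (_ * _).
rewrite [RHS]big_mkcond; apply: eq_bigr => j _.
by rewrite -(porbit_insert_max s k).
Qed.

Lemma det_col_max (R : comNzRingType) N (A : 'M[R]_N.+1) :
  (forall i : 'I_N, A (widenS i) ord_max = 0) ->
  \det A = A ord_max ord_max * \det (\matrix_(i, j) A (widenS i) (widenS j)).
Proof.
move=> A0; rewrite (expand_det_col _ ord_max) big_ord_recr /= big1 ?add0r; last first.
  by move=> i _; rewrite A0 mul0r.
rewrite /cofactor -signr_odd addnn odd_double mul1r; congr (_ * \det _).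
by apply/matrixP => i j; rewrite !mxE !lift_maxE.
Qed.

(** When [s'] arises from [t] by inserting the largest element after [k'], adding
the last row to [x_max] times the row [t k'] clears the last column except on
the diagonal, and leaves the matrix of [t] with the weight of [t k'] multiplied by
[x_max]. Cycle products are unchanged by this merging of weights. The factor [x_max]
created on both sides cancels, whence the assumption on the weights. *)
Lemma det_weighted_mx (R : idomainType) N (x : 'I_N -> R) (s : 'S_N) :
  (forall i, x i != 0) ->
  \det (weighted_mx x s) =
  \prod_(i | cycle_min s i) (\prod_(j in porbit s i) x j - 1).
Proof.
elim: N => [|N IH] in x s * => x0.
  by rewrite det_mx00 big_pred0// => -[].
have [t [k ->]] := insert_maxP s; rewrite big_mkcond big_ord_recr /=.
rewrite cycle_min_insert_max.
have prodE : \prod_(i < N) (if cycle_min (insert_max t k) (widenS i)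
      then \prod_(j in porbit (insert_max t k) (widenS i)) x j - 1 else 1) =
    \prod_(i | cycle_min t i) ((\prod_(j in porbit t i) x (widenS j)) *
      (if ord_max \in porbit (insert_max t k) (widenS i) then x ord_max else 1) - 1).
  rewrite [RHS]big_mkcond; apply: eq_bigr => i _.
  by rewrite cycle_min_insert_widenS prod_porbit_insert.
rewrite [X in X * _]prodE {prodE}.
have mxE' (y : 'I_N.+1 -> R) u i j : weighted_mx y u i j = y i *+ (i == j) - (i == u j)%:R.
  by rewrite mxE.
have wE (i j : 'I_N) : (widenS i == widenS j) = (i == j) by exact: inj_eq (@widenS_inj N) i j.
case: (widenSP k) => [->|[k' ->]].
  rewrite eqxx (porbit_fix (insert_max_fix t)) big_set1 det_col_max; last first.
    by move=> i; rewrite mxE' insert_max_fix (negbTE (widenS_neq_max i)) subrr.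
  rewrite mxE' insert_max_fix eqxx mulr1n mulrC; congr (_ * _).
  rewrite (_ : (\matrix_(_, _) _) = weighted_mx (fun i => x (widenS i)) t); last first.
    apply/matrixP => i j; rewrite !mxE wE insert_max_old ?wE//.
    by rewrite eq_sym widenS_neq_max.
  rewrite IH => [|i]; last exact: x0.
  apply: eq_bigr => i _; rewrite porbit_sym porbit_insert_fix mulr1//.
rewrite (negbTE (widenS_neq_max k')) mulr1.
set s' := insert_max t (widenS k'); pose r := widenS (t k').
have s'max : s' ord_max = r by exact: insert_max_widenS.
have s'k : s' (widenS k') = ord_max by exact: insert_maxE.
have s'w j : j != k' -> s' (widenS j) = widenS (t j).
  by move=> jk; rewrite /s' insert_max_old// wE eq_sym.
set M := weighted_mx x s'.
pose A : 'M[R]_(N.+1) := \matrix_(i, j) if i == r then x ord_max * M r j + M ord_max j else M i j.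
pose C : 'M[R]_(N.+1) := \matrix_(i, j) if i == r then M ord_max j else M i j.
have rmax : r != ord_max by exact: widenS_neq_max.
have maxr : ord_max != r by rewrite eq_sym.
have liftr i : (lift r i == r) = false by rewrite eq_sym; exact/negbTE/neq_lift.
(* [A] is the matrix after the row operation; [C] has two equal rows. *)
have detA : \det A = x ord_max * \det M.
  rewrite (@determinant_multilinear _ _ A M C r (x ord_max) 1).
  - rewrite [\det C](determinant_alternate rmax) ?mulr0 ?addr0//.
    by move=> j; rewrite [LHS]mxE [RHS]mxE eqxx (negbTE maxr).
  - by apply/rowP => j; rewrite !mxE eqxx mul1r.
  - by apply/matrixP => i j; rewrite [LHS]mxE 2![RHS]mxE liftr.
  - by apply/matrixP => i j; rewrite 2![LHS]mxE 2![RHS]mxE !liftr.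
apply: (mulfI (x0 ord_max)); rewrite -detA det_col_max; last first.
  move=> i; rewrite mxE; case: eqP => [_|/eqP ir].
    rewrite !mxE' s'max !eqxx (negbTE rmax) (negbTE maxr) mulr0n mulr1n.
    by rewrite sub0r subr0 mulrN1 addNr.
  by rewrite mxE' s'max (negbTE ir) (negbTE (widenS_neq_max i)) subrr.
have -> : A ord_max ord_max = x ord_max.
  by rewrite mxE (negbTE maxr) mxE' s'max eqxx (negbTE maxr) subr0.
congr (_ * _).
pose x' j := x (widenS j) * (if j == t k' then x ord_max else 1).
rewrite (_ : (\matrix_(_, _) _) = weighted_mx x' t); last first.
  apply/matrixP => i j; rewrite mxE [RHS]mxE mxE /x' {1}/r wE.
  have wmax (l : 'I_N) : (ord_max == widenS l) = false.
    by rewrite eq_sym; exact/negbTE/widenS_neq_max.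
  have [->|ik] := eqVneq i (t k').
    rewrite -/r !mxE' /r wE wmax mulr0n sub0r (inj_eq perm_inj).
    have [->|jk] := eqVneq j k'.
      rewrite s'k eqxx (negbTE (widenS_neq_max _)) subr0 mulrnAr.
      by rewrite mulrC.
    have kj : (k' == j) = false by rewrite eq_sym; exact/negbTE.
    by rewrite s'w// wmax wE (inj_eq perm_inj) kj !subr0 mulrnAr mulrC.
  rewrite mxE' wE mulr1; congr (_ - _%:R).
  have [->|jk] := eqVneq j k'; first by rewrite s'k (negbTE (widenS_neq_max _)) (negbTE ik).
  by rewrite s'w// wE.
rewrite IH; last by move=> i; rewrite mulf_neq0//; case: ifP; rewrite ?oner_eq0.
apply: eq_bigr => i _; congr (_ - 1); rewrite big_split /=; congr (_ * _).
have -> : (ord_max \in porbit s' (widenS i)) = (t k' \in porbit t i).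
  rewrite [LHS]porbit_sym porbit_insert_widenS -!eq_porbit_mem porbit_image.
  exact: eq_sym.
case: ifPn => ti.
  by rewrite (bigD1 (t k'))//= eqxx big1 ?mulr1// => j /andP[_ /negbTE ->].
rewrite big1// => j ji; case: eqP => // e; by rewrite -e ji in ti.
Qed.

Lemma char_poly_permutation_matrix (R : realType) N (s : 'S_N) :
  char_poly (permutation_matrix R s) =
  \prod_(i | cycle_min s i) ('X^#|porbit s i| - 1).
Proof.
rewrite /char_poly (_ : char_poly_mx _ = weighted_mx (fun=> 'X) s); last first.
  by apply/matrixP => j k; rewrite !mxE rmorph_nat.
rewrite det_weighted_mx; last by move=> i; rewrite polyX_eq0.
by apply: eq_bigr => i _; rewrite prodr_const.
Qed.

Lemma mup_prod (F : fieldType) (I : Type) (r : seq I) (P : pred I) (p : I -> {poly F}) z :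
  (forall i, P i -> p i != 0) ->
  mup z (\prod_(i <- r | P i) p i) = (\sum_(i <- r | P i) mup z (p i))%N.
Proof.
move=> p0; apply: (proj2 (_ : _ != 0 /\ _)).
apply: (big_rec2 (fun q m => q != 0 /\ mup z q = m)) => [|i m q Pi [q0 <-]].
  by rewrite oner_neq0 mupNroot// root1.
by rewrite mulf_neq0 ?mupM// p0.
Qed.

(** The derivative [n * X^(n-1)] does not vanish at a root of [X^n - 1]. *)
Lemma mup_Xn_sub1 (F : numFieldType) (z : F) n : (0 < n)%N ->
  mup z ('X^n - 1) = (z ^+ n == 1).
Proof.
move=> n0; have rootE : root ('X^n - 1 : {poly F}) z = (z ^+ n == 1).
  by rewrite rootE !hornerE subr_eq0.
case: (boolP (z ^+ n == 1)) => [zn|]; last by rewrite -rootE => /mupNroot.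
have p0 : 'X^n - 1 != 0 :> {poly F} by rewrite -size_poly_gt0 size_Xn_sub_1.
apply/eqP; rewrite eqn_leq mup_leq// mup_geq// expr1 dvdp_XsubCl rootE zn andbT.
apply/negP => /dvdpP[q qE]; have := congr1 (fun p => p^`().[z]) qE.
rewrite derivB derivXn derivC subr0 derivM expr2 derivM !hornerE subrr.
rewrite !(mulr0, mul0r, addr0, add0r) hornerMn hornerXn => /eqP.
rewrite /= mulr0 mulrn_eq0 (gtn_eqF n0) expf_eq0 => /andP[_ /eqP z0].
by move: zn; rewrite z0 expr0n (gtn_eqF n0) eq_sym oner_eq0.
Qed.

Lemma unit_circleX (R : realType) N (x : R) n :
  unit_circle N x ^+ n = unit_circle N (x * n%:R).
Proof.
elim: n => [|n IH].
  by rewrite expr0 mulr0 /unit_circle mulr0 mul0r cos0 sin0.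
have tE : 2 * pi * (x * n.+1%:R) / N%:R = 2 * pi * x / N%:R + 2 * pi * (x * n%:R) / N%:R.
  by rewrite -[n.+1%:R]natr1; ring.
rewrite exprS IH /unit_circle tE cosD sinD.
by congr Complex; ring.
Qed.

Lemma cos_eq1 (R : realType) (t : R) : 0 <= t < 2 * pi -> cos t = 1 -> t = 0.
Proof.
move=> /andP[t0 t2] ct; apply/eqP/negP => tn0.
have s0 : 0 < sin (t / 2).
  have t_gt0 : 0 < t by rewrite lt_neqAle eq_sym t0 andbT; exact/negP.
  by apply: sin_gt0_pi; apply/andP; split; lra.
have := cosD (t / 2) (t / 2); rewrite -splitr ct -!expr2 cos2sin2.
have := exprn_gt0 2 s0; lra.
Qed.

Lemma periodicz (U V : zmodType) (f : U -> V) T : periodic f T ->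
  forall (k : int) a, f (a + T *~ k) = f a.
Proof.
move=> fT [n|n] a; first exact: periodicn.
by rewrite -[in RHS](subrK (T *+ n.+1) a) (periodicn fT).
Qed.

(** Only the angle [0] of the interval [[0, 2 * pi[] has cosine one; periodicity
reduces to this interval. *)
Lemma unit_circle_eq1 (R : realType) N (x : R) :
  unit_circle N x = 1 <-> exists k : int, x / N%:R = k%:~R.
Proof.
have pi0 := @pi_gt0 R.
have tE : 2 * pi * x / N%:R = pi *+ 2 * (x / N%:R) by rewrite -mulr_natl; ring.
rewrite /unit_circle tE; set y := x / N%:R; split=> [[ct _]|[k ->]]; last first.
  rewrite mulrzr -[pi *+ 2 *~ k]add0r.
  by rewrite (periodicz (@cosD2pi R)) (periodicz (@sinD2pi R)) cos0 sin0.
exists (Num.floor y); apply/eqP; rewrite -subr_eq0.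
have p2 : pi *+ 2 != 0 :> R by rewrite mulrn_eq0 (gt_eqF pi0).
suff /eqP : pi *+ 2 * (y - (Num.floor y)%:~R) = 0 by rewrite mulf_eq0 (negbTE p2).
have /andP[k1 k2] := floor_itv y.
apply: cos_eq1; last first.
  by rewrite mulrBr mulrzr -mulrNz (periodicz (@cosD2pi R)).
move: k1 k2; rewrite intrD; move: (_%:~R : R) => f k1 k2.
rewrite -[pi *+ 2]mulr_natl; apply/andP; split; nra.
Qed.

Lemma mup_unit_circle (R : realType) N (s : 'S_N) (x : R) :
  mup (unit_circle N x) (char_poly (permutation_matrix R s)) =
  (\sum_(i | cycle_min s i)
    `[< exists k : int, x * #|porbit s i|%:R / N%:R = k%:~R >])%N.
Proof.
have card_gt0 i : (0 < #|porbit s i|)%N.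
  by apply/card_gt0P; exists i; exact: porbit_id.
rewrite char_poly_permutation_matrix mup_prod => [|i _]; last first.
  by rewrite -size_poly_gt0 size_Xn_sub_1.
apply: eq_bigr => i _; rewrite mup_Xn_sub1// unit_circleX; congr nat_of_bool.
by apply/eqP/asboolP => /unit_circle_eq1.
Qed.

End charpoly.

(** * Integrals against the point measures *)

Section esum.
Variable R : realType.
Local Open Scope ereal_scope.

Lemma esum_widen (I : choiceType) (D E : set I) (F : I -> \bar R) :
  D `<=` E -> (forall i, E i -> ~ D i -> F i = 0) ->
  \esum_(i in D) F i = \esum_(i in E) F i.
Proof.
move=> DE F0; rewrite [LHS]esum_mkcond [RHS]esum_mkcond; apply: eq_esum => i _.
case: ifPn => [/set_mem/DE/mem_set -> //|/negP iD]; case: ifPn => // /set_mem iE.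
by rewrite F0// => Di; apply: iD; exact: mem_set.
Qed.

Lemma le_sum_esum (I : choiceType) (D : set I) (F : I -> \bar R) (s : seq I) :
  uniq s -> [set` s] `<=` D -> \sum_(i <- s) F i <= \esum_(i in D) F i.
Proof.
move=> us sD; apply: esum_ge; exists [set` s]; first by split.
by rewrite -fsbig_seq.
Qed.

Lemma esum_seq (I : choiceType) (D : set I) (F : I -> \bar R) (s : seq I) :
  (forall i, 0 <= F i) -> uniq s -> [set` s] `<=` D ->
  (forall i, D i -> i \notin s -> F i = 0) ->
  \esum_(i in D) F i = \sum_(i <- s) F i.
Proof.
move=> F0 us sD Fs; rewrite -(esum_widen sD); last first.
  by move=> i Di /negP si; exact: Fs.
rewrite esum_fset; [by rewrite [RHS]fsbig_seq|exact: finite_seq|by move=> i _].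
Qed.

Lemma esum_countType (I : countType) (D : set I) (F : I -> \bar R) :
  (forall i, 0 <= F i) ->
  \esum_(i in D) F i =
  \sum_(n <oo) (if pickle_inv n is Some i then if i \in D then F i else 0 else 0).
Proof.
move=> F0; rewrite nneseries_esumT; last by move=> n; case: pickle_inv => // i; case: ifP.
rewrite esum_mkcond; transitivity (\esum_(n in range (@pickle I))
   (if pickle_inv n is Some i then if i \in D then F i else 0 else 0)).
  rewrite esum_image; last by move=> i j _ _; exact: (pcan_inj pickleK_inv).
  by apply: eq_esum => i _; rewrite pickleK_inv.
apply: esum_widen => // n _ nI; case E : pickle_inv => [i|//].
by case: nI; exists i => //; have := @pickle_invK I n; rewrite /ocancel E.
Qed.

End esum.

Section point_measure.
Context d (T : measurableType d) (R : realType) (I : countType).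
Local Open Scope ereal_scope.

(** A countable family of Dirac masses is a series of measures indexed by [nat], for
which integration is termwise. *)
Lemma integral_point_measure (D : set I) (p : I -> T) (f : T -> \bar R) :
  measurable_fun setT f -> (forall x, 0 <= f x) ->
  \int[point_measure R D (fun=> 1%N) p]_x f x = \esum_(i in D) f (p i).
Proof.
move=> mf f0.
pose null : {measure set T -> \bar R} := mzero.
pose atom i : {measure set T -> \bar R} := \d_(p i).
pose m n := if pickle_inv n is Some i then if i \in D then atom i else null else null.
rewrite (eq_measure_integral (mseries m 0)); last first.
  move=> A mA _; rewrite /= /point_measure /mseries esum_countType.
    apply: eq_eseriesr => n _; rewrite /m; case: pickle_inv => // i.
    by case: ifP; rewrite ?mul1e.
  by move=> i; rewrite mul1e.
rewrite ge0_integral_measure_series// esum_countType//.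
apply: eq_eseriesr => n _; rewrite /m; case: pickle_inv => [i|].
  by case: ifP => _; rewrite ?integral_measure_zero// integral_dirac// diracT mul1e.
by rewrite integral_measure_zero.
Qed.

End point_measure.

Section tau.
Local Open Scope ereal_scope.
Variables (R : realType) (v : virtual_permutation).

Definition cycle_freq (i N : nat) : R := ((cycle_size v i N)%:R / N%:R)%R.

(** The multiplicity of a point [x] is the number of cycles, of proportion [y], such
that [x * y] is an integer. Exchanging the sum over [x] with the sum over cycles
leaves, for each cycle, the sum over the set of points [k / y]. *)
Lemma tauE N (A : set R) : tau (permutation_matrix R (v N)) A =
  point_measure R [set ik : nat * int | (ik.1 < N)%N && vmin v ik.1] (fun=> 1%N)
    (fun ik => ik.2%:~R / cycle_freq ik.1 N)%R A.
Proof.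
rewrite /tau /= /point_measure.
rewrite (@esum_widen _ _ _ [set: R])//; last first.
  move=> x _ /negP; rewrite eigenvalue_root_char => /mupNroot ->.
  by rewrite mul0e.
have indic_ge0 (y : R) : 0 <= \d_y A :> \bar R by [].
under eq_esum => x _.
  rewrite mup_unit_circle natr_sum -sumEFin ge0_sume_distrl; last by move=> i _; rewrite lee_fin.
  over.
rewrite esum_sum; last by move=> x i _ _; rewrite mule_ge0// lee_fin.
set y := cycle_freq ^~ N.
have inner (j : 'I_N) : cycle_min (v N) j ->
   \esum_(x in [set: R])
     ((`[< exists k : int,
          (x * #|porbit (v N) j|%:R / N%:R)%R = k%:~R >] : nat)%:R%:E * (\d_x A : \bar R)) = \esum_(k in [set: int]) \d_(k%:~R / y j : R)%R A.
  move=> mj; have yE : y j = (#|porbit (v N) j|%:R / N%:R)%R.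
    by rewrite /y /cycle_freq cycle_sizeE -vminE mj.
  have y0 : (y j != 0)%R.
    rewrite yE mulf_neq0 ?invr_eq0// pnatr_eq0 -lt0n; last exact: leq_ltn_trans (ltn_ord j).
    by apply/card_gt0P; exists j; exact: porbit_id.
  transitivity (\esum_(x in range (fun k : int => k%:~R / y j)%R) (\d_x A : \bar R)); last first.
    by rewrite esum_image// => k l _ _ /(divIf y0)/intr_inj.
  rewrite [RHS]esum_mkcond; apply: eq_esum => x _.
  have -> : `[< exists k : int, (x * #|porbit (v N) j|%:R / N%:R)%R = k%:~R >] =
     (x \in range (fun k : int => k%:~R / y j)%R).
    rewrite -mulrA -yE; apply/asboolP/idP => [[k xk]|/set_mem[k _ <-]].
      by apply/mem_set; exists k => //; rewrite -xk mulfK.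
    by exists k; rewrite divfK.
  by case: ifP; rewrite ?mul1e ?mul0e.
rewrite (eq_bigr _ inner).
transitivity (\esum_(i in [set i | (i < N)%N && vmin v i])
    \esum_(k in [set: int]) (\d_(k%:~R / y i : R)%R A : \bar R)).
  rewrite (@esum_seq _ _ _ _ [seq i <- iota 0 N | vmin v i]).
  - rewrite big_filter -[iota 0 N](_ : index_iota 0 N = _) ?big_mkord;
      last by rewrite /index_iota subn0.
    by apply: eq_bigl => j; rewrite vminE.
  - by move=> i; apply: esum_ge0.
  - by rewrite filter_uniq// iota_uniq.
  - by move=> i /=; rewrite mem_filter mem_iota /= => /andP[-> ->].
  - by move=> i /= /andP[iN mi]; rewrite mem_filter mem_iota iN mi.
rewrite esum_esum//; rewrite (_ : _ `*`` _ =
  [set ik : nat * int | (ik.1 < N)%N && vmin v ik.1]).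
  by apply: eq_esum => ik _; rewrite mul1e.
by apply/seteqP; split => [ik []|ik h]//; split.
Qed.

Lemma integral_tau N (f : R -> R) : measurable_fun setT f -> (forall x, (0 <= f x)%R) ->
  \int[tau (permutation_matrix R (v N))]_x (f x)%:E =
  \esum_(ik in [set ik : nat * int | (ik.1 < N)%N && vmin v ik.1])
     (f (ik.2%:~R / cycle_freq ik.1 N)%R)%:E.
Proof.
move=> mf f0; rewrite (eq_measure_integral _ (fun A _ _ => tauE N A)).
by rewrite integral_point_measure//; exact/measurable_EFinP.
Qed.

(** The sum over the rank [m] of the block is reindexed by the smallest element of
the block. *)
Lemma integral_tau_infty (f : R -> R) : (forall i, exists2 j, (i <= j)%N & vmin v j) ->
  measurable_fun setT f -> (forall x, (0 <= f x)%R) ->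
  \int[tau_infty R v]_x (f x)%:E =
  \esum_(ik in [set ik : nat * int | vmin v ik.1]) (f (ik.2%:~R / limn (cycle_freq ik.1))%R)%:E.
Proof.
move=> inf_min mf f0; rewrite integral_point_measure//; last first.
  exact/measurable_EFinP.
have [e [he e_inj e_surj]] := nth_cycle_enum inf_min.
have lengthE m : cycle_length R v m = limn (cycle_freq (e m)).
  congr (limn _); apply/funext => N; have [mem ne] := he m.
  by rewrite /cycle_frequency ne card_trace_block.
rewrite (reindex_esum [set: nat * int] _ (fun mk => (e mk.1, mk.2))).
  by apply: eq_esum => -[m k] _ /=; rewrite lengthE.
split.
- by move=> [m k] _ /=; case: (he m).
- by move=> [m k] [n l] _ _ /= [/e_inj -> ->].
- by move=> [i k] /= /e_surj[m <-]; exists (m, k).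
Qed.

End tau.

(** * Convergence under regular growth *)

Section growth.
Variables (R : realType) (v : virtual_permutation).
Hypothesis growth : regular_growth R v.

(** An element whose cycle avoids [{0, ..., i-1}] has a cycle minimum at least
[i]. *)
Lemma infinitely_many_minima i : exists2 j, (i <= j)%N & vmin v j.
Proof.
have [_ _ /(_ i)[N hN]] := growth.
have [k nk] : exists k : 'I_N, ~~ touches (v N) i k.
  apply/existsP; rewrite -negb_forall; apply: contraTN hN => /forallP h.
  rewrite -leqNgt -card_touches -[leqLHS](card_ord N); apply/eq_leq/esym/eq_card => k.
  by rewrite !inE h.
have [j mj jk] := ex_cycle_min (v N) k.
exists j; last by rewrite -vminE.
rewrite leqNgt; apply: contra nk => ji; apply/existsP; exists j.
by rewrite ji -jk porbit_id.
Qed.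

Lemma cycle_freqE i N : cycle_freq R v i N = old_freq v i.+1 N - old_freq v i N.
Proof.
by rewrite /cycle_freq /cycle_size natrB ?mulrBl//; exact: old_count_mono.
Qed.

Lemma cycle_freq_ge0 i N : 0 <= cycle_freq R v i N.
Proof. by rewrite divr_ge0. Qed.

Lemma old_freq_ge0 i N : 0 <= old_freq v i N :> R.
Proof. by rewrite divr_ge0. Qed.

(** The block of [i] has no element among those counted by [old_freq v i0], which
bounds all late blocks at once. *)
Lemma cycle_freq_le i0 i N : (i0 <= i)%N ->
  cycle_freq R v i N <= 1 - old_freq v i0 N.
Proof.
move=> i0i; rewrite cycle_freqE; apply: lerB.
  case: N => [|N]; first by rewrite /old_freq invr0 mulr0.
  by rewrite ler_pdivrMr ?ltr0n// mul1r ler_nat old_count_le.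
by rewrite ler_wpM2r ?invr_ge0// ler_nat old_count_mono.
Qed.

Lemma cycle_freq_le1 i N : cycle_freq R v i N <= 1.
Proof. by apply: le_trans (cycle_freq_le _ (leqnn i)) _; rewrite gerBl old_freq_ge0. Qed.

Lemma cvg_cycle_freq i : cycle_freq R v i @ \oo --> limn (cycle_freq R v i).
Proof.
have [cvg_old _ _] := growth.
apply: (cvgP (limn (@old_freq R v i.+1) - limn (@old_freq R v i))).
rewrite (_ : cycle_freq R v i = fun N => old_freq v i.+1 N - old_freq v i N).
  by apply: cvgB; exact: cvg_old.
by apply/funext => N; rewrite cycle_freqE.
Qed.

Lemma cycle_limit_ge0 i : 0 <= limn (cycle_freq R v i).
Proof.
apply: limr_ge; first exact: cvgP (@cvg_cycle_freq i).
by apply: nearW => N; exact: cycle_freq_ge0.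
Qed.

Lemma cycle_limit_le1 i : limn (cycle_freq R v i) <= 1.
Proof.
apply: limr_le; first exact: cvgP (@cvg_cycle_freq i).
by apply: nearW => N; exact: cycle_freq_le1.
Qed.

Lemma small_cycles (e : R) : 0 < e -> exists i0,
  (\forall N \near \oo, forall i, (i0 <= i)%N -> cycle_freq R v i N < e) /\
  (forall i, (i0 <= i)%N -> limn (cycle_freq R v i) < e).
Proof.
move=> e0; have [cvg_old exhaust _] := growth; have [i0 Li0] := exhaust e e0.
exists i0; split.
  have : \forall N \near \oo, 1 - e < @old_freq R v i0 N.
    by apply: (cvgr_gt _ (cvg_old i0)).
  by apply: filterS => N hN i /(cycle_freq_le N); lra.
move=> i i0i; apply: (@le_lt_trans _ _ (1 - limn (@old_freq R v i0))); last by lra.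
have c1 : (fun N => 1 - @old_freq R v i0 N) @ \oo --> 1 - limn (@old_freq R v i0).
  by apply: cvgB; [exact: cvg_cst|exact: cvg_old].
rewrite -(cvg_lim (@Rhausdorff R) c1); apply: ler_lim.
- exact: cvgP (@cvg_cycle_freq i).
- exact: cvgP c1.
- by apply: nearW => N; exact: cycle_freq_le.
Qed.

End growth.

Section compact_support.
Variables (R : realType) (f : R -> R) (A : R).
Hypotheses (f_continuous : continuous f) (A_gt0 : 0 < A) (f00 : f 0 = 0).
Hypothesis supp : forall x, f x != 0 -> `|x| <= A.

(** The only delicate case is [u N --> 0]: the points [k / u N] with [k <> 0]
leave the support of [f], and [k / 0] is [0], where [f] vanishes. *)
Lemma cvg_lattice_point (k : int) (u : nat -> R) (l : R) : (forall N, 0 <= u N) ->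
  u @ \oo --> l -> (fun N => f (k%:~R / u N)) @ \oo --> f (k%:~R / l).
Proof.
move=> u0 ul; have [->|k0] := eqVneq k 0.
  by rewrite mul0r; under eq_fun do rewrite mul0r; exact: cvg_cst.
have [l0|l0] := eqVneq l 0; last first.
  apply: continuous_cvg; first exact: f_continuous.
  by apply: cvgMr; apply: cvgV.
rewrite l0 invr0 mulr0 f00; apply: cvg_near_cst.
have : \forall N \near \oo, u N < A^-1.
  by apply: (cvgr_lt _ ul); rewrite l0 invr_gt0.
apply: filterS => N uA; apply/eqP; apply: contraT => /[dup] fN /supp.
have [uN|uN] := eqVneq (u N) 0; first by rewrite uN invr0 mulr0 f00 eqxx in fN.
have uN0 : 0 < u N by rewrite lt_neqAle eq_sym uN u0.
rewrite normrM normfV (gtr0_norm uN0) ler_pdivrMr// => kA.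
have k1 : 1 <= `|k%:~R : R| by rewrite -intr_norm ler1z; rewrite -gtz0_ge1 normr_gt0.
have := lt_le_trans uA (_ : A^-1 <= u N); rewrite ltxx => ->//.
by rewrite -[A^-1]mul1r ler_pdivrMr// mulrC (le_trans k1).
Qed.

Lemma mem_int_box (K : nat) (k : int) :
  `|k| < K%:Z -> k \in [seq n%:Z - K%:Z | n <- iota 0 K.*2].
Proof.
move=> kK; apply/mapP; exists (absz (k + K%:Z)); first by rewrite mem_iota; lia.
lia.
Qed.

(** The pairs (cycle minimum, [k]) that can contribute when [f] is supported in
[[-A, A]] and the proportions of the blocks from [i0] on are below [1 / A]. *)
Definition lattice_box (i0 : nat) : seq (nat * int) :=
  [seq (i, k) | i <- iota 0 i0,
     k <- [seq n%:Z - (Num.truncn A).+1%:Z | n <- iota 0 (Num.truncn A).+1.*2]].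

Lemma lattice_box_uniq i0 : uniq (lattice_box i0).
Proof.
apply: allpairs_uniq; first exact: iota_uniq.
  by rewrite map_inj_uniq ?iota_uniq// => m n /addIr [].
by move=> [i k] [j l] _ _ [-> ->].
Qed.

Lemma lattice_box_support (u : nat -> R) i0 : (forall i, 0 <= u i <= 1) ->
  (forall i, (i0 <= i)%N -> u i < A^-1) ->
  forall ik, ik \notin lattice_box i0 -> f (ik.2%:~R / u ik.1) = 0.
Proof.
move=> u01 uA [i k] /=; apply: contraNeq => /[dup] fN /supp.
have /andP[ui0 ui1] := u01 i.
have [uN|uN] := eqVneq (u i) 0; first by rewrite uN invr0 mulr0 f00 eqxx in fN.
have [kN|k0] := eqVneq k 0; first by rewrite kN mul0r f00 eqxx in fN.
have uN0 : 0 < u i by rewrite lt_neqAle eq_sym uN ui0.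
rewrite normrM normfV (gtr0_norm uN0) ler_pdivrMr// => kA.
have k1 : 1 <= `|k%:~R : R| by rewrite -intr_norm ler1z; rewrite -gtz0_ge1 normr_gt0.
apply/allpairsP; exists (i, k); split => //.
  rewrite mem_iota ltnNge; apply/negP => /uA; apply/negP; rewrite -leNgt.
  by rewrite -[A^-1]mul1r ler_pdivrMr// mulrC (le_trans k1).
have kA' : `|k%:~R : R| < (Num.truncn A).+1%:R.
  apply: le_lt_trans (truncnS_gt A); apply: le_trans kA _.
  by rewrite ler_piMr// ltW.
move: kA'; rewrite -intr_norm -[X in _ < X]/((_.+1 : int)%:~R) ltr_int => kK.
exact: mem_int_box.
Qed.

End compact_support.

Lemma cvg_sumr (R : realType) (I : Type) (s : seq I) (F : I -> nat -> R) (l : I -> R) :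
  (forall i, F i @ \oo --> l i) ->
  (fun N => \sum_(i <- s) F i N) @ \oo --> \sum_(i <- s) l i.
Proof.
move=> Fl; elim: s => [|i s IH].
  by rewrite big_nil; under eq_fun do rewrite big_nil; exact: cvg_cst.
by rewrite big_cons; under eq_fun do rewrite big_cons; exact: cvgD.
Qed.

(** With [f 0 = 0], a pair whose first component is not a cycle minimum has
proportion [0] and contributes [f (k / 0) = f 0 = 0], so that all sums may be
taken over all pairs. *)
Lemma tau_cvg (R : realType) (v : virtual_permutation) (f : R -> R) :
  regular_growth R v -> continuous f -> (forall x, 0 <= f x) ->
  compact (closure [set x | f x != 0]) ->
  (fun N => \int[tau (permutation_matrix R (v N))]_x (f x)%:E)%E @ \oo
    --> (\int[tau_infty R v]_x (f x)%:E)%E.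
Proof.
move=> growth fc f0 fsupp.
have mf : measurable_fun setT f by exact: continuous_measurable_fun.
have inf_min := infinitely_many_minima growth.
rewrite integral_tau_infty//.
rewrite (_ : (fun N => _) = fun N =>
    (\esum_(ik in [set ik : nat * int | (ik.1 < N)%N && vmin v ik.1])
     (f (ik.2%:~R / cycle_freq R v ik.1 N)%R)%:E)%E); last first.
  by apply/funext => N; rewrite integral_tau.
have [f00|f00] := eqVneq (f 0) 0.
  have [A A0 supp] : exists2 A, 0 < A & forall x, f x != 0 -> `|x| <= A.
    have [A [Areal hA]] := compact_bounded fsupp.
    exists (`|A| + 1); first by rewrite ltr_wpDl.
    by move=> x fx; apply: hA; [rewrite ltr_pwDr// ler_norm|exact: subset_closure].
  have iA0 : 0 < A^-1 by rewrite invr_gt0.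
  have [i0 [small small_lim]] := small_cycles growth iA0.
  have nmin0 i N : ~~ vmin v i -> cycle_freq R v i N = 0.
    by move=> mi; rewrite /cycle_freq cycle_size_nmin// mul0r.
  have esumE (D : set (nat * int)) (u : nat -> R) : (forall i, 0 <= u i <= 1) ->
      (forall i, (i0 <= i)%N -> u i < A^-1) -> (forall ik, ~ D ik -> u ik.1 = 0) ->
      (\esum_(ik in D) (f (ik.2%:~R / u ik.1)%R)%:E =
        (\sum_(ik <- lattice_box A i0) f (ik.2%:~R / u ik.1))%:E)%E.
    move=> u01 uA uD; rewrite (@esum_widen _ _ _ setT)//; last first.
      by move=> ik _ /uD ->; rewrite invr0 mulr0 f00.
    rewrite (@esum_seq _ _ _ _ (lattice_box A i0))//.
    - by rewrite sumEFin.
    - by move=> ik; rewrite lee_fin.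
    - exact: lattice_box_uniq.
    - by move=> ik _ /(lattice_box_support A0 f00 supp u01 uA) ->.
  rewrite (esumE _ (fun i => limn (cycle_freq R v i))); last 3 first.
  - by move=> i; rewrite cycle_limit_ge0// cycle_limit_le1.
  - exact: small_lim.
  - move=> ik /negP mik; apply/cvg_lim => //.
    rewrite (_ : cycle_freq R v ik.1 = fun=> 0); first exact: cvg_cst.
    by apply/funext => N; exact: nmin0.
  apply: (@cvg_trans _ ((fun N => (\sum_(ik <- lattice_box A i0)
      f (ik.2%:~R / cycle_freq R v ik.1 N))%:E) @ \oo)).
    apply: near_eq_cvg; apply: filterS small => N small; rewrite (esumE _ (cycle_freq R v ^~ N))//.
    - by move=> i; rewrite cycle_freq_ge0 cycle_freq_le1.
    - move=> ik /= /negP; rewrite negb_and -leqNgt => /orP[Ni|/nmin0 ->//].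
      by rewrite /cycle_freq cycle_size_out// mul0r.
  apply: cvg_EFin; first exact: nearW.
  apply: cvg_sumr => ik; apply: (cvg_lattice_point fc A0 f00 supp).
    by move=> N; exact: cycle_freq_ge0.
  exact: cvg_cycle_freq.
have f00' : 0 < f 0 by rewrite lt_neqAle eq_sym f00 f0.
have [e [he e_inj _]] := nth_cycle_enum inf_min.
have lower (D : set (nat * int)) (u : nat -> R) m : (forall j, (j < m)%N -> D (e j, 0)) ->
    ((m%:R * f 0)%:E <= \esum_(ik in D) (f (ik.2%:~R / u ik.1)%R)%:E)%E.
  move=> De; apply: le_trans (le_sum_esum (s := [seq (e j, 0) | j <- iota 0 m]) _ _ _).
  - rewrite sumEFin big_map lee_fin (eq_bigr (fun=> f 0)); last first.
      by move=> j _; rewrite mul0r.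
    by rewrite big_const_seq count_predT size_iota iter_addr_0 mulr_natl.
  - by rewrite map_inj_uniq ?iota_uniq// => i j [/e_inj].
  - by move=> ik /= /mapP[j]; rewrite mem_iota => jm ->; exact: De.
have large (M : R) : exists m, M <= m%:R * f 0.
  exists (Num.truncn (M / f 0)).+1; rewrite -ler_pdivrMr//.
  exact/ltW/truncnS_gt.
rewrite (_ : \esum_(_ in _) _ = +oo)%E; last first.
  apply/eqyP => M _; have [m Mm] := large M.
  apply: le_trans (lower _ (fun i => limn (cycle_freq R v i)) m _); first by rewrite lee_fin.
  by move=> j _ /=; case: (he j).
apply/cvgeyPge => M; have [m Mm] := large M.
near=> N; apply: le_trans (lower _ (cycle_freq R v ^~ N) m _); first by rewrite lee_fin.
move=> j jm /=; rewrite (he j).1 andbT.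
have : (\max_(j < m) e j < N)%N by near: N; exists (\max_(j < m) e j).+1.
by apply: leq_ltn_trans; exact: (leq_bigmax (Ordinal jm)).
Unshelve. all: by end_near. Qed.

Theorem proposition4p1 (R : realType) (theta : R) (theta_gt0 : 0 < theta)
    (d : measure_display) (Omega : measurableType d) (P : probability Omega R)
    (sigma : Omega -> virtual_permutation)
    (M : Omega -> forall N : nat, 'M[R[i]]_N)
    (sigma_ewens : ewens_distributed P theta sigma)
    (M_sigma : forall w N, M w N = permutation_matrix R (sigma w N))
    (f : R -> R) (f_continuous : continuous f) (f_ge0 : forall x, 0 <= f x)
    (f_support : compact (closure [set x | f x != 0])) :
  {ae P, forall w,
    (fun N => \int[tau (M w N)]_x (f x)%:E)%E @ \oo
      --> (\int[tau_infty R (sigma w)]_x (f x)%:E)%E}.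
Proof.
have := ae_regular_growth theta_gt0 sigma_ewens; apply: filterS => w growth.
rewrite (_ : M w = fun N => permutation_matrix R (sigma w N)); last first.
  by apply: functional_extensionality_dep => N; exact: M_sigma.
exact: tau_cvg.
Qed.
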